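(* Let $\sigma:[0,\infty)\to[0,\infty)$ be nondecreasing with $\lim_{t\to\infty}\sigma(t)=\infty$, let $\alpha>0$, and take $a\ge 0$ such that $\sigma(x)>0$ for $x\ge a$. Then the following are equivalent: (i) there exists $C>0$ such that $\int_1^{\infty}\frac{\sigma(yt)}{t^{1+\alpha}}\,dt\le C\sigma(y)+C$ for all $y>0$; (ii) there exists a nondecreasing function $\kappa:[0,\infty)\to[0,\infty)$ such that $\sigma\sim\kappa$, $\kappa(0)=\sigma(0)/\alpha^2$, $\kappa$ satisfies (i) (i.e. there is $C'>0$ with $\int_1^{\infty}\frac{\kappa(yt)}{t^{1+\alpha}}\,dt\le C'\kappa(y)+C'$ for all $y>0$), and $t\mapsto\kappa(t^{1/\alpha})$ is concave; (iii) $\lim_{\varepsilon\to 0}\limsup_{t\to+\infty}\frac{\varepsilon^{\alpha}\sigma(t)}{\sigma(\varepsilon t)}=0$; (iv) there exists $K>1$ such that $\limsup_{t\to+\infty}\frac{\sigma(Kt)}{\sigma(t)}<K^{\alpha}$; (v) $\gamma(\sigma)>1/\alpha$; (vi) $\alpha(\sigma)<\alpha$; (vii) there exists $\gamma\in(0,\alpha)$ such that $t\mapsto\sigma(t)/t^{\gamma}$ is almost decreasing in $[a,\infty)$ if $a>0$, and in $[\varepsilon,\infty)$ for every $\varepsilon>0$ if $a=0$; (viii) there exists $C>0$ such that $\int_a^{y}\frac{t^{\alpha}}{\sigma(t)}\frac{dt}{t}\le \frac{Cy^{\alpha}}{\sigma(y)}$ for all $y\ge a$; (ix) there exists $C>0$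 such that $\sum_{k=\lceil a\rceil+1}^{p}\frac{k^{\alpha-1}}{\sigma(k)}\le C\frac{p^{\alpha}}{\sigma(p)}$ for all $p\in\mathbb{N}$ with $p\ge\lceil a\rceil+1$; (x) for every $\theta\in(0,1)$ there exists $k\in\mathbb{N}$, $k\ge 2$, such that $\sigma(kp)\le\theta k^{\alpha}\sigma(p)$ for every $p\in\mathbb{N}$ with $p\ge\lceil a\rceil+1$; (xi) there exists $k\in\mathbb{N}$, $k\ge 2$, such that $\limsup_{p\in\mathbb{N},\,p\to\infty}\frac{\sigma(kp)}{\sigma(p)}<k^{\alpha}$; (xii) there exists $C>0$ such that $\sum_{k=p}^{\infty}\frac{\sigma(k)}{k^{1+\alpha}}\le C\frac{\sigma(p)}{p^{\alpha}}$ for every $p\in\mathbb{N}$ with $p\ge\lceil a\rceil$.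
   Context: $\mathbb{N}=\{1,2,\dots\}$, $\lceil x\rceil=\min\{k\in\mathbb{Z}:x\le k\}$. For functions $\sigma,\tau:I\to[0,\infty)$ on an unbounded interval $I\subseteq[0,\infty)$, $\sigma\sim\tau$ means there is $C\ge1$ with $C^{-1}\tau(t)-C\le\sigma(t)\le C\tau(t)+C$ for all $t\in I$. A function $h$ on $[a,\infty)$ is almost decreasing if there is $m>0$ with $m\,h(y)\le h(x)$ for all $a\le x\le y$. For a measurable positive function $f$ on some $[A,\infty)$, its upper Matuszewska index is $\alpha(f):=\inf\{\alpha\in\mathbb{R}:\exists C_\alpha>0\ \forall\Lambda>1,\ \limsup_{x\to\infty}\sup_{\lambda\in[1,\Lambda]}\frac{f(\lambda x)}{\lambda^{\alpha}f(x)}\le C_\alpha\}$ (with $\inf\emptyset=\infty$); for $\sigma$ as in the claim, $\alpha(\sigma)$ means the index of the restriction of $\sigma$ to any $[A,\infty)$ with $A>0$ on which $\sigma>0$ (this does not depend on $A$). For $\gamma>0$, say $(P_{\sigma,\gamma})$ holds if there is $K>1$ with $\limsup_{t\to\infty}\sigma(K^{\gamma}t)/\sigma(t)<K$; $\gamma(\sigma):=\sup\{\gamma>0:(P_{\sigma,\gamma})\text{ holds}\}$, and $\gamma(\sigma):=0$ if no $(P_{\sigma,\gamma})$ holds. *)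

(* Defs.v *)
From HB Require Import structures.
From mathcomp Require Import all_boot all_order all_algebra.
From mathcomp Require Import all_classical all_reals all_analysis.
Set Implicit Arguments. Unset Strict Implicit. Unset Printing Implicit Defensive.
Import Order.TTheory GRing.Theory Num.Theory.
Import numFieldNormedType.Exports.
Local Open Scope classical_set_scope.
Local Open Scope ring_scope.

Section Defs.
Variable R : realType.
Implicit Types (f g sigma tau h : R -> R) (alpha a : R).

Definition limsup_pinfty (g : R -> R) : \bar R :=
  limf_esup (fun t => (g t)%:E) (+oo%R : set_system R).

Definition sim_on (I : set R) sigma tau : Prop :=
  exists C : R, 1 <= C /\ forall t, I t ->
    C^-1 * tau t - C <= sigma t /\ sigma t <= C * tau t + C.

Definition almost_decreasing_from h a : Prop :=
  exists m : R, 0 < m /\ forall x y, a <= x -> x <= y -> m * h y <= h x.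

Definition concave_nonneg f : Prop :=
  forall x y l : R, 0 <= x -> 0 <= y -> 0 <= l <= 1 ->
    l * f x + (1 - l) * f y <= f (l * x + (1 - l) * y).

Definition integral_cond sigma alpha : Prop :=
  exists C : R, 0 < C /\ forall y : R, 0 < y ->
    (\int[lebesgue_measure]_(t in `[1%R, +oo[)
        ((sigma (y * t) / t `^ (1 + alpha))%R%:E) <= (C * sigma y + C)%R%:E)%E.

Definition P_prop sigma (gam : R) : Prop :=
  exists K : R, 1 < K /\
    (limsup_pinfty (fun t => (sigma (K `^ gam * t) / sigma t)%R) < K%:E)%E.

Definition gamma_index sigma : \bar R :=
  let S := [set g%:E | g in [set g : R | 0 < g /\ P_prop sigma g]] in
  if `[< S = set0 >] then 0%E else ereal_sup S.

Definition matuszewska_upper f : \bar R :=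
  ereal_inf [set b%:E | b in [set b : R | exists Cb : R, 0 < Cb /\
     forall L : R, 1 < L ->
       (limf_esup (fun x => ereal_sup
            [set (f (l * x) / (l `^ b * f x))%R%:E | l in `[1%R, L]])
          (+oo%R : set_system R) <= Cb%:E)%E]].

(* ceil a, as a natural number (a >= 0 in the theorem) *)
Definition ceiln a : nat := `|Num.ceil a|%N.

End Defs.

(* Main.v *)
(* All conditions are equivalent to power growth below alpha: for some
   0 < gam < alpha and C > 0, sigma (l x) <= C l^gam sigma x for all l >= 1 and
   all x >= a, x > 0. It follows from one eventual estimate
   sigma (K t) <= c sigma t with c < K^alpha: writing c = K^gam, iterate and use
   monotonicity between consecutive powers of K. The limsup conditions are such
   an estimate almost verbatim. For the sums in (ix) and (xii), the dyadic block
   next to p is comparable to the bound p^alpha / sigma p (resp. its inverse), so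
   the sums change at least geometrically along p, 2p, 4p, etc., which gives the
   estimate with K = 2^n; the integrals in (i) and (viii) dominate these sums.
   For (ii), kappa is up to the factor alpha^-2 the least concave majorant of
   u |-> sigma (u^(1/alpha)), with its value at 0 lowered to sigma 0: power growth
   bounds the majorant by a multiple of sigma + 1, because
   sigma (v^(1/alpha)) <= C (v/u) (sigma (u^(1/alpha)) + 1) for v >= u. *)
Require Import Defs.
From HB Require Import structures.
From mathcomp Require Import all_boot all_order all_algebra.
From mathcomp Require Import all_classical all_reals all_analysis.
From mathcomp Require Import measurable_realfun.
From mathcomp Require Import ring lra zify.
Import Order.TTheory GRing.Theory Num.Theory.
Import numFieldNormedType.Exports.
Local Open Scope classical_set_scope.
Local Open Scope ring_scope.

(** * Eventual bounds and limits superior along a filter *)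

Lemma limf_esup_lt_near {T : choiceType} {X : filteredType T} {R : realType}
    (f : X -> \bar R) (F : set_system X) (FF : Filter F) (c : \bar R) :
  (limf_esup f F < c)%E -> \forall x \near F, (f x < c)%E.
Proof.
move=> /ereal_inf_lt[_ [V FV <-] supV]; apply: filterS FV => x Vx.
by apply: le_lt_trans supV; apply: ereal_sup_ubound; exists x.
Qed.

Lemma limf_esup_le_near {T : choiceType} {X : filteredType T} {R : realType}
    (f : X -> \bar R) (F : set_system X) (c : \bar R) :
  (\forall x \near F, (f x <= c)%E) -> (limf_esup f F <= c)%E.
Proof.
move=> Fc; apply: (@le_trans _ _ (ereal_sup (f @` [set x | (f x <= c)%E]))).
  by apply: ereal_inf_lbound; exists [set x | (f x <= c)%E].
by apply: ge_ereal_sup => _ [x fx <-].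
Qed.

(** Iterating an estimate needs a real bound [d] strictly below [c]; an eventual bound by [c] itself
    would lose the gap. The supremum of [g] over a set of the filter serves, raised to [e] where it
    is smaller, for instance [-oo] over the empty set. *)
Lemma limf_esup_EFin_lt {T : choiceType} {X : filteredType T} {R : realType}
    (g : X -> R) (F : set_system X) (FF : Filter F) (c e : R) : e < c ->
  (limf_esup (fun x => (g x)%:E) F < c%:E)%E ->
  exists d, e <= d < c /\ \forall x \near F, g x <= d.
Proof.
move=> ec /ereal_inf_lt[_ [V FV <-] supV].
have gV x : V x -> ((g x)%:E <= ereal_sup [set (g x)%:E | x in V])%E.
  by move=> Vx; apply: ereal_sup_ubound; exists x.
move: supV gV; case: (ereal_sup _) => [r| |] //= rc gV.
  exists (Num.max e r); split; first by rewrite le_max lexx gt_max ec -lte_fin.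
  by apply: filterS FV => x /gV; rewrite lee_fin le_max => ->; rewrite orbT.
exists e; rewrite lexx ec; split=> //.
by apply: filterS FV => x /gV; rewrite leeNy_eq.
Qed.

(** * Real powers and geometric sequences *)

Section PowR.
Context {R : realType}.
Implicit Types x y z d M K c al q l : R.

Lemma ge1_powR x d : 1 <= x -> 0 <= d -> 1 <= x `^ d.
Proof. by move=> x1 d0; rewrite -[leLHS](powRr0 x) ler_powR. Qed.

Lemma gt1_powR x d : 1 < x -> 0 < d -> 1 < x `^ d.
Proof.
move=> x1 d0; have x0 := lt_trans ltr01 x1.
have := @gt0_ltr_powR R d d0 1 x; rewrite powR1 !nnegrE; apply=> //; exact: ltW.
Qed.

Lemma powRV x d : 0 <= x -> x^-1 `^ d = (x `^ d)^-1.
Proof. by move=> x0; rewrite -powR_inv1 // powRAC powR_inv1 ?powR_ge0. Qed.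

Lemma gt0_powRD x d c : 0 < x -> x `^ (d + c) = x `^ d * x `^ c.
Proof. by move=> x0; rewrite powRD // (gt_eqF x0) implybT. Qed.

Lemma gt0_powRB x d c : 0 < x -> x `^ (d - c) = x `^ d / x `^ c.
Proof. by move=> x0; rewrite powRB // (gt_eqF x0) implybT. Qed.

Lemma powR_gt_exists d M : 0 < d -> exists2 K, 1 < K & M < K `^ d.
Proof.
move=> d0; have M1 : 1 < Num.max M 1 + 1 by rewrite ltrDr lt_max ltr01 orbT.
exists ((Num.max M 1 + 1) `^ d^-1).
  by rewrite gt1_powR ?invr_gt0.
rewrite -powRrM mulVf ?gt_eqF // powRr1; last exact: ltW (lt_trans ltr01 M1).
by rewrite ltr_pwDr // le_max lexx.
Qed.

Lemma powR_exponent_exists K c al : 1 < K -> 1 < c -> c < K `^ al ->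
  exists2 be, 0 < be < al & K `^ be = c.
Proof.
move=> K1 c1 cK; have K0 := lt_trans ltr01 K1; have c0 := lt_trans ltr01 c1.
have lnK0 : 0 < ln K by rewrite ln_gt0.
exists (ln c / ln K); last first.
  by rewrite /powR (gt_eqF K0) divfK ?gt_eqF // lnK.
by rewrite divr_gt0 ?ln_gt0 //= ltr_pdivrMr // -ln_powR ltr_ln // posrE powR_gt0.
Qed.

(** [n] is the integer part of the logarithm of [l] in base [K]. *)
Lemma between_powers K l : 1 < K -> 1 <= l ->
  exists n : nat, K ^+ n <= l < K ^+ n.+1.
Proof.
move=> K1 l1; have K0 := lt_trans ltr01 K1; have l0 := lt_le_trans ltr01 l1.
have lnK0 : 0 < ln K by rewrite ln_gt0.
exists (Num.truncn (ln l / ln K)).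
have /truncn_itv/andP[] : 0 <= ln l / ln K by rewrite divr_ge0 ?ln_ge0 // ltW.
rewrite ler_pdivlMr // ltr_pdivrMr // -!ln_powR ler_ln ?ltr_ln ?posrE ?powR_gt0 //.
by rewrite !powR_mulrn ?(ltW K0) // => -> ->.
Qed.

Lemma expr_gt_exists K M : 1 < K -> exists n : nat, M < K ^+ n.
Proof.
move=> K1; have [|n /andP[_ MK]] := @between_powers K (Num.max M 1) K1.
  by rewrite le_max lexx orbT.
by exists n.+1; apply: le_lt_trans MK; rewrite le_max lexx.
Qed.

Lemma exprM_lt1_exists q M : 0 < q < 1 -> exists n : nat, M * q ^+ n < 1.
Proof.
move=> /andP[q0 q1]; have [|n] := @expr_gt_exists q^-1 M; first by rewrite invf_gt1.
by exists n; rewrite -ltr_pdivlMr ?exprn_gt0 // div1r -exprVn.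
Qed.

End PowR.

(** * Power growth *)

Definition power_growth {R : realType} (s : R -> R) (a gam : R) : Prop :=
  exists C : R, 0 < C /\ forall x l, a <= x -> 0 < x -> 1 <= l ->
    s (l * x) <= C * l `^ gam * s x.

Section Growth.
Context {R : realType}.
Variables (s : R -> R) (al a : R).
Hypothesis s_ge0 : forall x : R, 0 <= x -> 0 <= s x.
Hypothesis s_nd : forall x y : R, 0 <= x -> x <= y -> s x <= s y.
Hypothesis al_gt0 : 0 < al.
Hypothesis a_ge0 : 0 <= a.
Hypothesis s_gt0 : forall x, a <= x -> 0 < s x.

Lemma dilation_iter K T c n t : 1 < K -> 0 < T -> 0 < c ->
  (forall t, T <= t -> s (K * t) <= c * s t) -> T <= t ->
  s (K ^+ n * t) <= c ^+ n * s t.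
Proof.
move=> K1 T0 c0 Kc Tt; elim: n => [|n IH]; first by rewrite !expr0 !mul1r.
rewrite !exprS -mulrA; apply: (le_trans (Kc _ _)).
  by rewrite (le_trans Tt) // ler_peMl ?exprn_ege1 ?ltW // (lt_le_trans T0).
by rewrite -mulrA ler_pM2l.
Qed.

(** This is the common way into power growth. With [c = K^gam], iteration handles the powers of [K],
    and monotonicity of [s] handles the factors [l] between two consecutive powers. *)
Lemma dilation_power_growth K T c : 1 < K -> c < K `^ al ->
  (forall t, T <= t -> s (K * t) <= c * s t) ->
  exists2 gam : R, 0 < gam < al & power_growth s a gam.
Proof.
move=> K1 cK Kc; have K0 := lt_trans ltr01 K1.
have Kal1 : 1 < K `^ al by exact: gt1_powR.
(* Enlarging [c] to a number strictly between 1 and [K^al] makes the exponent [gam] positive and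
   keeps it below [al]. *)
pose c1 := Num.max c ((1 + K `^ al) / 2).
have c1gt1 : 1 < c1 by rewrite lt_max midf_lt // orbT.
have c1K : c1 < K `^ al by rewrite gt_max cK midf_lt.
have c10 := lt_trans ltr01 c1gt1.
have [gam gam_int Kgam] := @powR_exponent_exists R K c1 al K1 c1gt1 c1K.
exists gam => //; have [gam0 _] := andP gam_int.
pose S := Num.max T (Num.max a 1).
have S0 : 0 < S by rewrite !lt_max ltr01 !orbT.
have aS : a <= S by rewrite !le_max lexx orbT.
have Kc1 t : S <= t -> s (K * t) <= c1 * s t.
  move=> St; apply: (le_trans (Kc _ _)); first by rewrite (le_trans _ St) // le_max lexx.
  by rewrite ler_wpM2r ?le_max ?lexx // s_ge0 // (le_trans _ St) // ltW.
(* If [K^n <= l < K^(n+1)], then [n + 1] iterations cost [c1^(n+1) = c1 (K^n)^gam <= c1 l^gam]. *)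
have growS l t : 1 <= l -> S <= t -> s (l * t) <= c1 * l `^ gam * s t.
  move=> l1 St; have [n /andP[nl ln]] := between_powers _ _ K1 l1.
  have t0 := lt_le_trans S0 St.
  apply: (@le_trans _ _ (s (K ^+ n.+1 * t))).
    by rewrite s_nd ?ler_wpM2r ?mulr_ge0 ?ltW // (lt_le_trans _ l1).
  apply: (le_trans (@dilation_iter K S c1 _ _ K1 S0 c10 Kc1 St)).
  rewrite ler_wpM2r ?s_ge0 ?(ltW t0) // exprS ler_pM2l //.
  rewrite -Kgam -powR_mulrn ?powR_ge0 // -powRrM mulrC powRrM powR_mulrn ?(ltW K0) //.
  by rewrite ge0_ler_powR ?nnegrE ?exprn_ge0 ?(ltW gam0) ?(ltW K0) ?(le_trans ler01 l1).
have sa0 : 0 < s a by apply: s_gt0.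
have Ca : 1 <= s S / s a by rewrite ler_pdivlMr // mul1r s_nd.
(* For [a <= x < S] the growth is measured at [S] instead: [s (l x) <= s (l S)], and
   [s S <= (s S / s a) s x]. *)
exists (c1 * (s S / s a)); split; first by rewrite mulr_gt0 // (lt_le_trans _ Ca).
move=> x l ax x0 l1; have sx0 := s_gt0 _ ax; have l0 := lt_le_trans ltr01 l1.
have [Sx|xS] := leP S x.
  apply: (le_trans (growS _ _ l1 Sx)); rewrite ler_pM2r // ler_wpM2r ?powR_ge0 //.
  by rewrite ler_peMr // ltW.
apply: (@le_trans _ _ (s (l * S))).
  by rewrite s_nd ?mulr_ge0 ?ler_pM2l // ltW.
apply: (le_trans (growS _ _ l1 (lexx _))).
have -> : c1 * (s S / s a) * l `^ gam * s x =
  c1 * l `^ gam * s S * (s x / s a) by ring.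
have c1l0 : 0 <= c1 * l `^ gam by rewrite mulr_ge0 ?powR_ge0 ?ltW.
rewrite ler_peMr ?(mulr_ge0 c1l0) ?(ltW (s_gt0 _ aS)) //.
by rewrite ler_pdivlMr // mul1r s_nd.
Qed.

End Growth.

(** * Limsup and almost-monotonicity conditions *)

Lemma near_pinfty_geP {R : realType} (P : R -> Prop) b :
  (\forall x \near +oo, P x) -> exists T, b <= T /\ forall t, T <= t -> P t.
Proof.
move=> [M [_ MP]]; exists (Num.max b (M + 1)); rewrite le_max lexx; split=> // t.
by rewrite ge_max => /andP[_ Mt]; apply: MP; rewrite (lt_le_trans _ Mt) // ltrDl.
Qed.

Lemma near_pinfty_ge {R : realType} (P : R -> Prop) T :
  (forall t, T <= t -> P t) -> \forall x \near +oo, P x.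
Proof. by move=> TP; exists T; split=> [|x /ltW /TP //]; rewrite num_real. Qed.

Section Conditions.
Context {R : realType}.
Variables (s : R -> R) (al a : R).
Hypothesis s_ge0 : forall x : R, 0 <= x -> 0 <= s x.
Hypothesis s_nd : forall x y : R, 0 <= x -> x <= y -> s x <= s y.
Hypothesis al_gt0 : 0 < al.
Hypothesis a_ge0 : 0 <= a.
Hypothesis s_gt0 : forall x, a <= x -> 0 < s x.

Let hub := exists2 gam : R, 0 < gam < al & power_growth s a gam.
Let dilation K T c := @dilation_power_growth R s al a s_ge0 s_nd al_gt0 a_ge0 s_gt0 K T c.

Lemma limsup_dilation_growth K : 1 < K ->
  (limsup_pinfty (fun t => (s (K * t) / s t)%R) < (K `^ al)%R%:E)%E -> hub.
Proof.
move=> K1 /(@limf_esup_EFin_lt _ _ _ _ _ _ _ 0 (powR_gt0 _ (lt_trans ltr01 K1))).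
move=> [d [/andP[_ dK]] /near_pinfty_geP - /(_ a) [T [aT Td]]].
apply: (@dilation K T d) => // t Tt.
by rewrite -ler_pdivrMr ?Td // s_gt0 // (le_trans aT).
Qed.

(** With [be] midway between [gam] and [al], a large [K] absorbs the constant: [C K^gam < K^be].
    Keeping [be] strictly below [al] is what later makes the gamma index strictly larger than
    [1/al]. *)
Lemma growth_limsup_dilation : hub -> exists be, 0 < be < al /\
  exists K, 1 < K /\ (limsup_pinfty (fun t => (s (K * t) / s t)%R) < (K `^ be)%R%:E)%E.
Proof.
move=> [gam /andP[gam0 gamal]] [C [C0 sC]].
have [be0 beal] : 0 < (gam + al) / 2 /\ (gam + al) / 2 < al.
  by split; [rewrite divr_gt0 // addr_gt0 | rewrite midf_lt].
exists ((gam + al) / 2); rewrite be0 beal; split=> //.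
have gb : 0 < (gam + al) / 2 - gam by rewrite subr_gt0 midf_lt.
have [K K1 CK] := @powR_gt_exists R _ C gb.
have K0 := lt_trans ltr01 K1.
exists K; split=> //; apply: (@le_lt_trans _ _ (C * K `^ gam)%:E); last first.
  rewrite lte_fin -ltr_pdivlMr ?powR_gt0 // -gt0_powRB //.
apply: limf_esup_le_near; apply: (@near_pinfty_ge _ _ (Num.max a 1)) => t.
rewrite ge_max => /andP[at_ t1]; rewrite lee_fin ler_pdivrMr ?s_gt0 //.
by apply: sC => //; [exact: lt_le_trans t1|exact: ltW].
Qed.

Lemma growth_limsup_dilation_lt : hub -> exists K, 1 < K /\
  (limsup_pinfty (fun t => (s (K * t) / s t)%R) < (K `^ al)%R%:E)%E.
Proof.
move=> /growth_limsup_dilation[be [/andP[_ beal] [K [K1 h]]]].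
exists K; split=> //; apply: (lt_le_trans h).
by rewrite lee_fin ler_powR ?(ltW K1) ?(ltW beal).
Qed.

Lemma growth_gamma_index : hub -> ((al^-1)%R%:E < gamma_index s)%E.
Proof.
move=> /growth_limsup_dilation[be [/andP[be0 beal] [K [K1 h]]]].
(* The property at [1/be] is tested with the base [K^be], whose power of exponent [1/be] is [K]. *)
have S : [set g | 0 < g /\ P_prop s g] be^-1.
  rewrite /= invr_gt0; split=> //; exists (K `^ be); rewrite gt1_powR //.
  by rewrite -powRrM divff ?gt_eqF // powRr1 ?ltW // (lt_trans ltr01).
rewrite /gamma_index; case: asboolP => [S0|_].
  by have : (set0 : set (\bar R)) be^-1%:E by rewrite -S0; exists be^-1.
apply: (@lt_le_trans _ _ (be^-1)%:E); last by apply: ereal_sup_ubound; exists be^-1.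
by rewrite lte_fin ltf_pV2 ?posrE.
Qed.

(** Some admissible [g] exceeds [1/al], so dilation by [K^g] costs less than [K < (K^g)^al]. The
    default value 0 of the index is excluded because [1/al] is nonnegative. *)
Lemma gamma_index_growth : ((al^-1)%R%:E < gamma_index s)%E -> hub.
Proof.
rewrite /gamma_index; case: asboolP => [_|_].
  by rewrite lte_fin ltNge invr_ge0 ltW.
move=> /ereal_sup_gt[_ [g [g0 [K [K1 h]]] <-]]; rewrite lte_fin => alg.
apply: (@limsup_dilation_growth (K `^ g)); first exact: gt1_powR.
apply: (lt_trans h); rewrite lte_fin -powRrM.
rewrite -[ltLHS]powRr1 ?(ltW (lt_trans ltr01 K1)) // /powR gt_eqF ?(lt_trans ltr01) //.
by rewrite ltr_expR ltr_pM2r ?ln_gt0 // -ltr_pdivrMr // div1r.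
Qed.

Lemma growth_matuszewska : hub -> (matuszewska_upper s < al%:E)%E.
Proof.
move=> [gam /andP[gam0 gamal]] [C [C0 sC]].
apply: (@le_lt_trans _ _ gam%:E); last by rewrite lte_fin.
apply: ereal_inf_lbound; exists gam => //; exists C; split=> // L L1.
apply: limf_esup_le_near; apply: (@near_pinfty_ge _ _ (Num.max a 1)) => t.
rewrite ge_max => /andP[at_ t1]; apply: ge_ereal_sup => _ [l + <-].
rewrite /= in_itv /= => /andP[l1 _].
rewrite lee_fin ler_pdivrMr ?mulr_gt0 ?powR_gt0 ?s_gt0 ?(lt_le_trans ltr01) //.
by rewrite mulrA sC // (lt_le_trans ltr01).
Qed.

(** [Cb] does not depend on the range [L], so [K] may be chosen after it, with
    [Cb + 1 < K^(al - b)]; the supremum over [[1, K]] is then used only at [l = K]. *)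
Lemma matuszewska_growth : (matuszewska_upper s < al%:E)%E -> hub.
Proof.
move=> /ereal_inf_lt[_ [b [Cb [Cb0 h]] <-]]; rewrite lte_fin => bal.
have bal0 : 0 < al - b by rewrite subr_gt0.
have [K K1 CK] := @powR_gt_exists R _ (Cb + 1) bal0.
have K0 := lt_trans ltr01 K1.
have : (limf_esup (fun x => ereal_sup
    [set (s (l * x) / (l `^ b * s x))%R%:E | l in `[1%R, K]])
    (+oo%R : set_system R) < (Cb + 1)%:E)%E.
  by apply: le_lt_trans (h _ K1) _; rewrite lte_fin ltrDl.
move=> /limf_esup_lt_near/near_pinfty_geP - /(_ a) [T [aT hT]].
apply: (@dilation K T ((Cb + 1) * K `^ b)) => //.
  rewrite -ltr_pdivlMr ?powR_gt0 // -gt0_powRB //.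
move=> t Tt; have st : 0 < s t by rewrite s_gt0 // (le_trans aT).
rewrite -mulrA -ler_pdivrMr ?mulr_gt0 ?powR_gt0 // -lee_fin.
apply: le_trans (ltW (hT _ Tt)); apply: ereal_sup_ubound; exists K => //.
by rewrite /= in_itv /= ltW //= lexx.
Qed.

Lemma growth_almost_decreasing gam b : 0 < gam -> a <= b -> 0 < b ->
  power_growth s a gam -> almost_decreasing_from (fun t => s t / t `^ gam) b.
Proof.
move=> gam0 ab b0 [C [C0 sC]]; exists C^-1; rewrite invr_gt0; split=> // x y bx xy.
have x0 := lt_le_trans b0 bx; have y0 := lt_le_trans x0 xy.
rewrite mulrC ler_pdivrMr // ler_pdivrMr ?powR_gt0 //.
have := sC x (y / x) (le_trans ab bx) x0; rewrite ler_pdivlMr // mul1r => /(_ xy).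
rewrite divfK ?gt_eqF // powRM ?invr_ge0 ?(ltW x0) ?(ltW y0) // powRV ?(ltW x0) //.
by congr (_ <= _); ring.
Qed.

(** Comparing [t] with [K t] gives the factor [m^-1 K^gam], which is below [K^al] once
    [K^(al - gam)] exceeds [m^-1]. *)
Lemma almost_decreasing_growth gam b : 0 < gam < al -> 0 < b ->
  almost_decreasing_from (fun t => s t / t `^ gam) b -> hub.
Proof.
move=> /andP[gam0 gamal] b0 [m [m0 hm]].
have d0 : 0 < al - gam by rewrite subr_gt0.
have [K K1 mK] := @powR_gt_exists R _ m^-1 d0; have K0 := lt_trans ltr01 K1.
apply: (@dilation K b (m^-1 * K `^ gam)) => //.
  rewrite -ltr_pdivlMr ?powR_gt0 // -gt0_powRB //.
move=> t bt; have t0 := lt_le_trans b0 bt.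
have tK : t <= K * t by rewrite ler_peMl ?(ltW t0) ?(ltW K1).
have := hm t (K * t) bt tK; rewrite powRM ?(ltW t0) ?(ltW K0) // => h.
have [Kg tg] : 0 < K `^ gam /\ 0 < t `^ gam by split; exact: powR_gt0.
have w0 : 0 <= m^-1 * K `^ gam * t `^ gam by rewrite !mulr_ge0 ?invr_ge0 ?powR_ge0 ?(ltW m0).
apply: le_trans (le_trans (ler_wpM2r w0 h) _); rewrite le_eqVlt; apply/orP; left; apply/eqP.
  by field; rewrite !gt_eqF.
by field; rewrite !gt_eqF.
Qed.

(** Power growth at the point [e t] with [l = 1/e] bounds the quotient by [C e^(al - gam)], which
    tends to 0 with [e]. *)
Lemma growth_limsup_contraction : hub ->
  (fun eps => limsup_pinfty (fun t => eps `^ al * s t / s (eps * t)))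
     x @[x --> 0^'+] --> 0%E.
Proof.
move=> [gam /andP[gam0 gamal]] [C [C0 sC]].
have d0 : 0 < al - gam by rewrite subr_gt0.
have cC : (C * eps `^ (al - gam))%:E @[eps --> 0^'+] --> 0%E.
  apply: cvg_EFin; first by near=> x.
  rewrite -[X in _ --> X](mulr0 C); apply: cvgM; first exact: cvg_cst.
  exact: powR_cvg0 d0.
apply: (squeeze_cvge _ (cvg_cst 0%E) cC).
near=> e; have e0 : 0 < e by near: e; exact: nbhs_right_gt.
have e1 : e <= 1 by near: e; apply: nbhs_right_le.
have ev t : Num.max a 1 / e <= t -> a <= e * t /\ 0 < e * t.
  rewrite ler_pdivrMr // mulrC ge_max => /andP[-> et]; split=> //.
  exact: lt_le_trans et.
apply/andP; split.
  (* The limsup is nonnegative: every neighbourhood of [+oo] contains a [t] at which the quotient is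
     nonnegative. *)
  apply: le_ereal_inf_tmp => _ [V [M [_ VM]] <-].
  pose t := Num.max (Num.max a 1 / e) (M + 1).
  have [aet et0] : a <= e * t /\ 0 < e * t by apply: ev; rewrite le_max lexx.
  apply: (@le_trans _ _ (e `^ al * s t / s (e * t))%:E).
    have t0 : 0 <= t by move: et0; rewrite pmulr_rgt0 // => /ltW.
    by rewrite lee_fin divr_ge0 ?mulr_ge0 ?powR_ge0 ?s_ge0 // ltW.
  apply: ereal_sup_ubound; exists t => //; apply: VM.
  by rewrite lt_max ltrDl ltr01 orbT.
apply: limf_esup_le_near; apply: (@near_pinfty_ge _ _ (Num.max a 1 / e)) => t.
move=> /ev[aet et0]; rewrite lee_fin ler_pdivrMr ?s_gt0 //.
have := sC (e * t) e^-1 aet et0; rewrite invf_ge1 // => /(_ e1).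
rewrite mulKf ?gt_eqF // => h.
have -> : C * e `^ (al - gam) * s (e * t) = e `^ al * (C * e^-1 `^ gam * s (e * t)).
  rewrite gt0_powRB //.
  rewrite powRV ?(ltW e0) //; ring.
by rewrite ler_wpM2l ?powR_ge0.
Unshelve. all: by end_near. Qed.

(** One [e] in []0, 1[] with limsup below 1/2 suffices: dilation by [1/e] then costs at most half of
    [(1/e)^al]. *)
Lemma limsup_contraction_growth :
  (fun eps => limsup_pinfty (fun t => eps `^ al * s t / s (eps * t)))
     x @[x --> 0^'+] --> 0%E -> hub.
Proof.
move=> h.
have h1 : \forall e \near 0^'+,
    (limsup_pinfty (fun t => (e `^ al * s t / s (e * t))%R) < (2^-1)%R%:E)%E.
  have /h : nbhs 0%E [set x : \bar R | (x < (2^-1)%R%:E)%E].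
    apply: open_nbhs_nbhs; split; first exact: open_ereal_lt_ereal.
    by rewrite /= lte_fin invr_gt0 ltr0n.
  by [].
have [e [/andP[e0 e1] he]] : exists e, 0 < e < 1 /\
    (limsup_pinfty (fun t => (e `^ al * s t / s (e * t))%R) < (2^-1)%R%:E)%E.
  near (0 : R)^'+ => e; exists e; split; last by near: e.
  by apply/andP; split; near: e; [exact: nbhs_right_gt | exact: nbhs_right_lt].
move: he => /limf_esup_lt_near/near_pinfty_geP - /(_ a) [T [aT hT]].
have V1 : 1 < e^-1 by rewrite invf_gt1.
apply: (@dilation e^-1 (Num.max T 1) (2^-1 * e^-1 `^ al)) => //.
  by rewrite gtr_pMl ?powR_gt0 ?invr_gt0 //; lra.
move=> t; rewrite ge_max => /andP[Tt t1]; have t0 := lt_le_trans ltr01 t1.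
have st : 0 < s t by rewrite s_gt0 // (le_trans aT).
have Tet : T <= e^-1 * t.
  by rewrite (le_trans Tt) // ler_peMl ?(ltW t0) ?(ltW V1).
have := ltW (hT _ Tet); rewrite lee_fin mulVKf ?gt_eqF // => h2.
rewrite ler_pdivrMr // in h2; rewrite powRV ?(ltW e0) // mulrAC.
by rewrite ler_pdivlMr ?powR_gt0 // mulrC.
Unshelve. all: by end_near. Qed.

End Conditions.

Lemma ceiln_ge {R : realType} (a : R) (p : nat) : 0 <= a -> (ceiln a <= p)%N -> a <= p%:R.
Proof.
move=> a0 ap; apply: (le_trans (Num.Theory.ceil_ge a)).
have c0 : 0 <= Num.ceil a by rewrite ceil_ge0 (lt_le_trans _ a0) // ltrN10.
by rewrite -[Num.ceil a]gez0_abs // ler_nat.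
Qed.

(** * Sums of powers *)

Section PowerSums.
Context {R : realType}.
Implicit Types d t : R.

(** Young's inequality for [t^d] and 1 with conjugate exponents [1/d] and [1/(1 - d)]; the right
    side is the tangent of [t^d] at 1. *)
Lemma powR_le_affine d t : 0 < d < 1 -> 0 <= t -> t `^ d <= d * t + (1 - d).
Proof.
move=> /andP[d0 d1] t0.
have := @conjugate_powR R (t `^ d) 1 d^-1 (1 - d)^-1 (powR_ge0 _ _) ler01.
rewrite !invr_gt0 subr_gt0 !invrK => /(_ d0 d1); rewrite addrC subrK => /(_ erefl).
by rewrite mulr1 -powRrM divff ?gt_eqF // powRr1 // powR1 mul1r mulrC.
Qed.

Lemma powR_pred_le d (k : nat) : 0 < d < 1 ->
  (k%:R : R) `^ d <= k.+1%:R `^ d * (1 - d / k.+1%:R).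
Proof.
move=> d01; have k0 : 0 < k.+1%:R :> R by rewrite ltr0n.
have := @powR_le_affine d (k%:R / k.+1%:R) d01; rewrite divr_ge0 // => /(_ isT).
rewrite powRM ?invr_ge0 // powRV // ler_pdivrMr ?powR_gt0 // => /le_trans; apply.
rewrite mulrC ler_wpM2l ?powR_ge0 // le_eqVlt; apply/orP; left; apply/eqP.
by rewrite -natr1; field; rewrite natr1 pnatr_eq0.
Qed.

(** A discrete mean value inequality that makes the sum of [k^-(1+d)] telescope. With [x = d/(k+1)]
    it combines the bound of [k^d] by [(k+1)^d (1 - x)] with [(1 + x)(1 - x) <= 1]. *)
Lemma powRN_diff_ge d (k : nat) : 0 < d < 1 -> (0 < k)%N ->
  d * (k.+1%:R : R) `^ (- (1 + d)) <= k%:R `^ (- d) - k.+1%:R `^ (- d).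
Proof.
move=> d01 k0; have [d0 d1] := andP d01.
have k1 : 0 < k.+1%:R :> R by rewrite ltr0n.
rewrite !powRN gt0_powRD //.
rewrite powRr1 //; have := @powR_pred_le d k d01.
have : 0 < (k%:R : R) `^ d by rewrite powR_gt0 // ltr0n.
have : 0 < (k.+1%:R : R) `^ d by rewrite powR_gt0.
move: (k%:R `^ d) (k.+1%:R `^ d) => x y y0 x0 xy.
have y1 : 0 < 1 - d / k.+1%:R.
  by rewrite subr_gt0 ltr_pdivrMr // mul1r (lt_le_trans d1) // ler1n.
rewrite lerBrDr; apply: (@le_trans _ _ (y * (1 - d / k.+1%:R))^-1); last first.
  by rewrite lef_pV2 ?posrE ?mulr_gt0.
rewrite -[leRHS]div1r ler_pdivlMr ?mulr_gt0 //.
have -> : (d * (k.+1%:R * y)^-1 + y^-1) * (y * (1 - d / k.+1%:R)) = 1 - (d / k.+1%:R) ^+ 2.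
  by move: (k.+1%:R : R) k1 => z z0; field; rewrite !gt_eqF.
by rewrite lerBlDr lerDl sqr_ge0.
Qed.

(** The first term is at most [p^-d]; the others telescope to at most [p^-d / d]. *)
Lemma sum_powRN_le d (p n : nat) : 0 < d < 1 -> (0 < p)%N ->
  \sum_(p <= k < n) (k%:R : R) `^ (- (1 + d)) <= (1 + d^-1) * p%:R `^ (- d).
Proof.
move=> d01 p0; have [d0 d1] := andP d01.
have pd : 0 <= (p%:R : R) `^ (- d) by rewrite powR_ge0.
have [np|pn] := leqP n p.
  by rewrite big_geq // mulr_ge0 ?addr_ge0 ?invr_ge0 // ltW.
rewrite big_ltn //; have p1 : 1 <= p%:R :> R by rewrite ler1n.
rewrite mulrDl mul1r lerD ?ler_powR ?lerN2 //; first by rewrite lerDr.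
suff : d * \sum_(p.+1 <= i < n) (i%:R : R) `^ (- (1 + d)) <= p%:R `^ (- d) - n.-1%:R `^ (- d).
  move=> h; rewrite ler_pdivlMl //; apply: (le_trans h).
  by rewrite lerBlDr lerDl powR_ge0.
case: n pn => // n /= pn; elim: n pn => [|n IH]; first by rewrite ltnS leqNgt p0.
rewrite ltnS leq_eqVlt => /predU1P[<-|pn].
  by rewrite big_geq ?mulr0 ?subrr.
rewrite big_nat_recr //= mulrDr; have n0 : (0 < n)%N by rewrite (leq_trans p0).
apply: (le_trans (lerD (IH _) (@powRN_diff_ge d n d01 n0))) => //.
by rewrite addrA subrK.
Qed.

End PowerSums.

(** * Discrete conditions *)

Section DiscreteConditions.
Context {R : realType}.
Variables (s : R -> R) (al a : R).
Hypothesis s_ge0 : forall x : R, 0 <= x -> 0 <= s x.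
Hypothesis s_nd : forall x y : R, 0 <= x -> x <= y -> s x <= s y.
Hypothesis al_gt0 : 0 < al.
Hypothesis a_ge0 : 0 <= a.
Hypothesis s_gt0 : forall x, a <= x -> 0 < s x.

Let hub := exists2 gam : R, 0 < gam < al & power_growth s a gam.
Let dilation K T c := @dilation_power_growth R s al a s_ge0 s_nd al_gt0 a_ge0 s_gt0 K T c.
Let natge p (ap : (ceiln a <= p)%N) : a <= p%:R := @ceiln_ge R a p a_ge0 ap.

(** Passing from integers to reals costs one extra dilation by [k], since [t] is compared with its
    integer part. A high power of [k] makes this fixed loss harmless. *)
Lemma nat_dilation_growth (k P : nat) d : (2 <= k)%N -> d < k%:R `^ al ->
  (forall p, (P <= p)%N -> s (k * p)%:R <= d * s p%:R) -> hub.
Proof.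
move=> k2 dk hd; have k1 : 1 < k%:R :> R by rewrite ltr1n.
have k0 : 0 < k%:R :> R by rewrite ltr0n (leq_trans _ k2).
pose e := Num.max d (k%:R `^ al / 2).
have e0 : 0 < e by rewrite lt_max divr_gt0 ?powR_gt0 // orbT.
have ka0 : 0 < (k%:R : R) `^ al by rewrite powR_gt0.
have ek : e < k%:R `^ al by rewrite gt_max dk ltr_pdivrMr // ltr_pMr // ltr1n.
have he n p : (P <= p)%N -> s (k ^ n * p)%:R <= e ^+ n * s p%:R.
  move=> Pp; elim: n => [|n IH]; first by rewrite expn0 mul1n expr0 mul1r.
  rewrite expnS -mulnA exprS -mulrA; apply: (le_trans (hd _ _)).
    by rewrite (leq_trans Pp) // leq_pmull // expn_gt0 (leq_trans _ k2).
  apply: (@le_trans _ _ (e * s (k ^ n * p)%:R)); last by rewrite ler_pM2l.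
  by rewrite ler_wpM2r ?s_ge0 // le_max lexx.
(* Replacing [t] by its integer part turns [e^N] into [e^(N+1)]; this [n] keeps the latter below
   [k^(al N)] for [N = n + 1]. *)
have [n en] : exists n, e ^+ 2 * (e / k%:R `^ al) ^+ n < 1.
  by apply: exprM_lt1_exists; rewrite divr_gt0 //= ltr_pdivrMr ?mul1r.
pose N := n.+1.
have K1 : 1 < (k ^ N)%:R :> R.
  by rewrite natrX exprn_egt1.
apply: (@dilation (k ^ N)%:R (Num.max a (P + 1)%:R) (e ^+ N.+1) K1).
  rewrite natrX -(powR_mulrn N (ltW k0)) powRAC powR_mulrn ?powR_ge0 //.
  rewrite exprS /N; rewrite -[ltRHS]mul1r -ltr_pdivrMr ?exprn_gt0 //.
  apply: le_lt_trans en; rewrite !exprS expr0 mulr1 expr_div_n.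
  have -> : e * (e * e ^+ n) / (k%:R `^ al * k%:R `^ al ^+ n) =
    e * e * (e ^+ n / k%:R `^ al ^+ n) / k%:R `^ al.
    by field; rewrite !expf_neq0 ?gt_eqF.
  rewrite ler_pdivrMr // ler_peMr //.
    by rewrite !mulr_ge0 ?invr_ge0 ?exprn_ge0 ?ltW.
  by rewrite ltW // gt1_powR.
move=> t; rewrite ge_max => /andP[at_ Pt].
have t0 : 0 <= t by exact: le_trans at_.
have /andP[pt tp] := truncn_itv t0; set p := Num.truncn t in pt tp.
have P1p : (P + 1 <= p)%N.
  by rewrite addn1 -ltnS -(ltr_nat R) (le_lt_trans _ tp) // -addn1.
have p1 : (p.+1 <= k * p)%N.
  (* From [k >= 2] and [p >= 1] follows [p + 1 <= 2 p <= k p], hence [t <= k p]. *)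
  rewrite (leq_trans _ (leq_mul k2 (leqnn p))) // mul2n -addnn -addn1 leq_add2l.
  by rewrite (leq_trans _ P1p) // addn1.
apply: (@le_trans _ _ (s (k ^ N.+1 * p)%:R)).
  apply: s_nd; first by rewrite mulr_ge0.
  by rewrite expnSr -mulnA natrM ler_wpM2l // (le_trans (ltW tp)) // ler_nat.
apply: (le_trans (he N.+1 p _)); first by rewrite (leq_trans _ P1p) // leq_addr.
by rewrite ler_wpM2l ?exprn_ge0 ?(ltW e0) // s_nd.
Qed.

Lemma limsup_nat_dilation_growth : (exists k : nat, (2 <= k)%N /\
  (limn_esup (fun p : nat => (s (k * p)%:R / s p%:R)%R%:E)
     < (k%:R `^ al)%R%:E)%E) -> hub.
Proof.
move=> [k [k2]]; have k0 : 0 < k%:R :> R by rewrite ltr0n (leq_trans _ k2).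
move=> /(@limf_esup_EFin_lt _ _ _ _ _ _ _ 0 (powR_gt0 _ k0)).
move=> [d [/andP[_ dk] [P _ hP]]].
apply: (@nat_dilation_growth k (maxn P (ceiln a)) d) => // p.
rewrite geq_max => /andP[Pp ap].
by rewrite -ler_pdivrMr ?s_gt0 ?natge //; apply: hP.
Qed.

Lemma growth_nat_dilation : hub ->
  forall theta : R, 0 < theta < 1 -> exists k : nat, (2 <= k)%N /\
     forall p : nat, (ceiln a + 1 <= p)%N ->
       s (k * p)%:R <= theta * k%:R `^ al * s p%:R.
Proof.
move=> [gam /andP[gam0 gamal] [C [C0 sC]]] theta /andP[th0 th1].
have d0 : 0 < al - gam by rewrite subr_gt0.
have [K K1 CK] := @powR_gt_exists R _ (C / theta) d0; have K0 := lt_trans ltr01 K1.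
(* Adding 2 secures both [K <= k] and [k >= 2]. *)
pose k := (Num.truncn K).+2; exists k; split=> // p ap.
have Kk : K <= k%:R.
  by have /andP[_ /ltW /le_trans] := truncn_itv (ltW K0); apply; rewrite ler_nat.
have ap' : (ceiln a <= p)%N by rewrite (leq_trans _ ap) // leq_addr.
have p0 : (0 < p)%N by rewrite (leq_trans _ ap) // addn1.
rewrite natrM; apply: (le_trans (sC p%:R k%:R _ _ _)); rewrite ?natge ?ltr0n ?ler1n //.
rewrite ler_wpM2r ?(ltW (s_gt0 _ _)) ?natge //.
have -> : theta * k%:R `^ al = theta * k%:R `^ (al - gam) * k%:R `^ gam.
  by rewrite -mulrA -gt0_powRD ?subrK.
rewrite ler_wpM2r ?powR_ge0 // mulrC -ler_pdivrMr // (le_trans (ltW CK)) //.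
by rewrite ge0_ler_powR ?nnegrE ?(ltW d0) ?(ltW K0).
Qed.

Lemma nat_dilation_limsup :
  (forall theta : R, 0 < theta < 1 -> exists k : nat, (2 <= k)%N /\
     forall p : nat, (ceiln a + 1 <= p)%N ->
       s (k * p)%:R <= theta * k%:R `^ al * s p%:R) ->
  exists k : nat, (2 <= k)%N /\
  (limn_esup (fun p : nat => (s (k * p)%:R / s p%:R)%R%:E)
     < (k%:R `^ al)%R%:E)%E.
Proof.
move=> h; have half01 : 0 < (2^-1 : R) < 1 by rewrite invr_gt0 ltr0n invf_lt1 ?ltr1n.
have [k [k2 hk]] := h _ half01.
exists k; split=> //; have k0 : 0 < k%:R :> R by rewrite ltr0n (leq_trans _ k2).
apply: (@le_lt_trans _ _ (2^-1 * k%:R `^ al)%R%:E).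
  apply: limf_esup_le_near; exists (ceiln a + 1)%N => // p /= ap.
  rewrite lee_fin ler_pdivrMr ?hk // s_gt0 // natge //.
  by rewrite (leq_trans _ ap) // leq_addr.
by rewrite lte_fin gtr_pMl ?powR_gt0 //; lra.
Qed.

(** [S] is comparable to [w p = s p / p^al] and contracts by [q] under doubling, so
    [w (2^n p) <= (C/c) q^n w p]. One doubling need not beat the loss [C/c], but enough doublings
    do. *)
Lemma doubling_growth (S : nat -> R) (P : nat) (q c C : R) : 0 < q < 1 -> 0 < c ->
  (0 < P)%N ->
  (forall p, (P <= p)%N -> S (2 * p)%N <= q * S p /\
     c * (s p%:R / p%:R `^ al) <= S p <= C * (s p%:R / p%:R `^ al)) -> hub.
Proof.
move=> q01 c0 P0 hS; have [q0 q1] := andP q01.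
have hq n p : (P <= p)%N -> S (2 ^ n * p)%N <= q ^+ n * S p.
  move=> Pp; elim: n => [|n IH]; first by rewrite expn0 mul1n expr0 mul1r.
  rewrite expnS -mulnA exprS -mulrA; have Pq : (P <= 2 ^ n * p)%N.
    by rewrite (leq_trans Pp) // leq_pmull // expn_gt0.
  have [h _] := hS _ Pq.
  by apply: (le_trans h); rewrite ler_pM2l.
have [n Cq] := @exprM_lt1_exists R q (C * q / c) q01.
have n1 : (2 <= 2 ^ n.+1)%N by rewrite -{1}(expn1 2) leq_exp2l.
pose k := (2 ^ n.+1)%N.
have ka0 : 0 < (k%:R : R) `^ al by rewrite powR_gt0 // ltr0n expn_gt0.
apply: (@nat_dilation_growth k P (C * q / c * q ^+ n * k%:R `^ al)) => //.
  by rewrite gtr_pMl.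
move=> p Pp; have p0 : 0 < p%:R :> R by rewrite ltr0n (leq_trans P0).
have pa0 : 0 < (p%:R : R) `^ al by rewrite powR_gt0.
have Pkp : (P <= k * p)%N by rewrite (leq_trans Pp) // leq_pmull // expn_gt0.
have [_ /andP[h1 _]] := hS _ Pkp; have [_ /andP[_ h2]] := hS _ Pp.
have qn0 : 0 <= q ^+ n.+1 by rewrite exprn_ge0 ?ltW.
have := le_trans h1 (le_trans (hq n.+1 p Pp) (ler_wpM2l qn0 h2)).
rewrite natrM powRM // -ler_pdivlMl // ler_pdivrMr ?mulr_gt0 // => /le_trans; apply.
rewrite le_eqVlt; apply/orP; left; apply/eqP; rewrite exprS.
by field; rewrite !gt_eqF.
Qed.

End DiscreteConditions.

(** * Weighted sums and their dyadic blocks *)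

Lemma double_le_bounds (c p : nat) : (2 * (c + 1) <= p)%N ->
  [/\ (0 < p)%N, (c <= p)%N, (c + 1 <= p)%N, (c + 1 <= p./2.+1)%N & (2 * (c + 1) <= 2 * p)%N].
Proof. by move=> h; split; lia. Qed.

Lemma half_lt_bounds (c p k : nat) : (2 * (c + 1) <= p)%N -> (p./2 < k)%N ->
  [/\ (0 < k)%N, (c <= k)%N & (p <= k * 2)%N].
Proof. by move=> h hk; split; lia. Qed.

Lemma upper_half_ge (p : nat) : (p <= (p.+1 - p./2.+1) * 2)%N.
Proof. lia. Qed.

Section SumConditions.
Context {R : realType}.
Variables (s : R -> R) (al a : R).
Hypothesis s_ge0 : forall x : R, 0 <= x -> 0 <= s x.
Hypothesis s_nd : forall x y : R, 0 <= x -> x <= y -> s x <= s y.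
Hypothesis al_gt0 : 0 < al.
Hypothesis a_ge0 : 0 <= a.
Hypothesis s_gt0 : forall x, a <= x -> 0 < s x.

Let hub := exists2 gam : R, 0 < gam < al & power_growth s a gam.
Let natge p (ap : (ceiln a <= p)%N) : a <= p%:R := @ceiln_ge R a p a_ge0 ap.

(** Raising [gam] weakens power growth, so it can be moved to within 1/2 of [al]; this puts
    [al - gam] in the range covered by [sum_powRN_le]. *)
Lemma power_growth_near : hub ->
  exists2 gam, 0 < gam < al & 0 < al - gam < 1 /\ power_growth s a gam.
Proof.
move=> [gam /andP[gam0 gamal] [C [C0 sC]]].
exists (Num.max gam (al - 2^-1)).
  by rewrite lt_max gam0 gt_max gamal /= gtrBl invr_gt0 ltr0n.
split.
  rewrite subr_gt0 gt_max gamal gtrBl invr_gt0 ltr0n /= ltrBlDr -ltrBlDl.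
  rewrite lt_max; apply/orP; right; lra.
exists C; split=> // x l ax x0 l1; apply: (le_trans (sC _ _ ax x0 l1)).
rewrite ler_wpM2r ?(ltW (s_gt0 _ ax)) // ler_pM2l // ler_powR //.
by rewrite le_max lexx.
Qed.

Lemma growth_quot gam C x y :
  (forall x l, a <= x -> 0 < x -> 1 <= l -> s (l * x) <= C * l `^ gam * s x) ->
  a <= x -> 0 < x -> x <= y -> s y <= C * (y `^ gam / x `^ gam) * s x.
Proof.
move=> sC ax x0 xy; have := sC x (y / x) ax x0.
rewrite ler_pdivlMr // mul1r divfK ?gt_eqF // => /(_ xy).
by rewrite powRM ?invr_ge0 ?(ltW x0) ?(le_trans (ltW x0)) // powRV ?(ltW x0).
Qed.

(** Comparing [s k] with [s p] through [(k/p)^gam] leaves the tail sum of [k^-(1 + al - gam)]. *)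
Lemma growth_tail_sum : hub ->
  exists C : R, 0 < C /\ forall p : nat, (1 <= p)%N -> (ceiln a <= p)%N ->
  (\sum_(p <= k <oo) ((s k%:R / k%:R `^ (1 + al))%R%:E)
    <= (C * (s p%:R / p%:R `^ al))%R%:E)%E.
Proof.
move=> /power_growth_near[gam /andP[gam0 gamal] [d01 [C [C0 sC]]]].
have [d0 _] := andP d01.
have D0 : 0 < 1 + (al - gam)^-1 by rewrite addr_gt0 ?invr_gt0.
exists (C * (1 + (al - gam)^-1)); rewrite mulr_gt0 //; split=> // p p0 ap.
have p0' : 0 < p%:R :> R by rewrite ltr0n.
have ap' := natge _ ap; have sp0 : 0 < s p%:R by rewrite s_gt0.
apply: lime_le.
  apply: is_cvg_nneseries => n _ _.
  by rewrite lee_fin divr_ge0 ?powR_ge0 ?s_ge0.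
apply: nearW => n; rewrite sumEFin lee_fin.
apply: (@le_trans _ _ (C * s p%:R / p%:R `^ gam * \sum_(p <= k < n) k%:R `^ (- (1 + (al - gam))))).
  rewrite mulr_sumr ler_sum_nat // => k /andP[pk kn].
  have k0 : 0 < k%:R :> R by rewrite ltr0n (leq_trans p0 pk).
  have pk' : p%:R <= k%:R :> R by rewrite ler_nat.
  have h := growth_quot gam C p%:R k%:R sC ap' p0' pk'.
  have -> : - (1 + (al - gam)) = - (1 + al) + gam by ring.
  rewrite [_ `^ (- (1 + al) + gam)]gt0_powRD //.
  rewrite powRN mulrCA mulrC ler_wpM2l ?invr_ge0 ?powR_ge0 //.
  by apply: (le_trans h); rewrite le_eqVlt; apply/orP; left; apply/eqP; ring.
have w0 : 0 <= C * s p%:R / p%:R `^ gam.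
  by rewrite !mulr_ge0 ?invr_ge0 ?powR_ge0 ?(ltW C0) ?(ltW sp0).
apply: (le_trans (ler_wpM2l w0 (@sum_powRN_le R _ _ n d01 p0))).
have -> : p%:R `^ al = p%:R `^ gam * p%:R `^ (al - gam).
  by rewrite -gt0_powRD // addrC subrK.
rewrite powRN le_eqVlt; apply/orP; left; apply/eqP.
by field; rewrite !gt_eqF ?powR_gt0.
Qed.

(** The block from [p] to [2p - 1] carries a fixed proportion of the tail [S p], so
    [S (2p) <= (1 - c/D) S p] and [doubling_growth] applies to the tails. *)
Lemma tail_sum_growth : (exists C : R, 0 < C /\ forall p : nat, (1 <= p)%N -> (ceiln a <= p)%N ->
  (\sum_(p <= k <oo) ((s k%:R / k%:R `^ (1 + al))%R%:E)
    <= (C * (s p%:R / p%:R `^ al))%R%:E)%E) -> hub.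
Proof.
move=> [C [C0 hC]].
pose u k := s k%:R / k%:R `^ (1 + al).
have u0 k : 0 <= u k by rewrite /u divr_ge0 ?powR_ge0 ?s_ge0.
pose S p := (\sum_(p <= k <oo) (u k)%:E)%E.
have S0 p : (0 <= S p)%E by apply: nneseries_ge0 => n _ _; rewrite lee_fin.
pose P := (maxn 1 (ceiln a)).
have finS p : (P <= p)%N -> S p \is a fin_num.
  rewrite geq_max => /andP[p1 ap]; rewrite ge0_fin_numE //.
  exact: le_lt_trans (hC p p1 ap) (ltry _).
pose c := 2 `^ (- (1 + al)) : R; have c0 : 0 < c by rewrite powR_gt0.
(* Adding [c] to [C] forces [c / D < 1], so that the contraction factor is positive. *)
pose D := C + c; have D0 : 0 < D by rewrite addr_gt0.
have block p : (P <= p)%N ->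
    c * (s p%:R / p%:R `^ al) <= \sum_(p <= k < p + p) u k.
  rewrite geq_max => /andP[p1 ap]; have p0 : 0 < p%:R :> R by rewrite ltr0n.
  (* Each of the [p] terms is bounded below by using [s k >= s p] and [k <= 2 p]. *)
  apply: (@le_trans _ _ (\sum_(p <= k < p + p) s p%:R / (2 * p%:R) `^ (1 + al))).
    rewrite sumr_const_nat addnK -[leRHS]mulr_natr powRM // /c powRN !gt0_powRD //.
    rewrite !powRr1 //; rewrite le_eqVlt; apply/orP; left; apply/eqP.
    by field; rewrite !gt_eqF ?powR_gt0.
  rewrite ler_sum_nat // => k /andP[pk kp].
  have k0 : 0 < k%:R :> R by rewrite ltr0n; lia.
  rewrite ler_pM ?s_ge0 ?invr_ge0 ?powR_ge0 //.
    by rewrite s_nd // ler_nat.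
  rewrite lef_pV2 ?posrE ?powR_gt0 ?mulr_gt0 // ge0_ler_powR ?nnegrE ?mulr_ge0 ?(ltW k0) //.
    by rewrite addr_ge0 // ltW.
  by rewrite -natrM ler_nat; lia.
have c1 : 0 < 1 - c / D < 1.
  by rewrite subr_gt0 ltr_pdivrMr // mul1r ltrDr C0 gtrBl divr_gt0.
apply: (@doubling_growth R s al a s_ge0 s_nd al_gt0 a_ge0 s_gt0
  (fun p => fine (S p)) P (1 - c / D) c D) => //.
  by rewrite /P; lia.
move=> p Pp; have [p1 ap] : (1 <= p)%N /\ (ceiln a <= p)%N by move: Pp; rewrite /P; lia.
have w0 : 0 < s p%:R / p%:R `^ al by rewrite divr_gt0 ?powR_gt0 ?ltr0n // s_gt0 ?natge.
have P2 : (P <= p + p)%N by rewrite (leq_trans Pp) // leq_addr.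
have split : fine (S p) = \sum_(p <= k < p + p) u k + fine (S (p + p)%N).
  rewrite {1}/S (nneseries_split p p); last by move=> k _; rewrite lee_fin.
  by rewrite fineD ?finS // sumEFin.
have SC : fine (S p) <= C * (s p%:R / p%:R `^ al).
  by rewrite -lee_fin fineK ?finS ?hC.
have SD : fine (S p) <= D * (s p%:R / p%:R `^ al).
  by apply: (le_trans SC); rewrite ler_pM2r // lerDl ltW.
rewrite mul2n -addnn SD andbT; split; last first.
  by apply: (le_trans (block _ Pp)); rewrite split lerDl fine_ge0.
rewrite mulrBl mul1r lerBrDr {2}split addrC lerD2r; apply: le_trans (block _ Pp).
by rewrite -mulrA ler_pM2l // ler_pdivrMl.
Qed.

(** Here the partial sums [J] grow: the upper half of the range up to [2p] carries at least the
    proportion [c/D] of [J (2p)], so [J p <= (1 - c/D) J (2p)]. Thus [1/J] contracts under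
    doubling. *)
Lemma sum_le_growth : (exists C : R, 0 < C /\ forall p : nat, (ceiln a + 1 <= p)%N ->
  \sum_(ceiln a + 1 <= k < p.+1) k%:R `^ (al - 1) / s k%:R
    <= C * (p%:R `^ al / s p%:R)) -> hub.
Proof.
move=> [C [C0 hC]]; pose A := (ceiln a + 1)%N.
pose u k := k%:R `^ (al - 1) / s k%:R.
have u0 k : 0 <= u k by rewrite /u divr_ge0 ?powR_ge0 ?s_ge0.
pose J p := \sum_(A <= k < p.+1) u k.
pose c := 2 `^ (- (1 + al)) : R; have c0 : 0 < c by rewrite powR_gt0.
pose D := C + c; have D0 : 0 < D by rewrite addr_gt0.
(* From [2 A] on, the upper half of the range lies entirely above the starting index [A]. *)
pose P := (2 * A)%N.
have block p : (P <= p)%N ->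
    c * (p%:R `^ al / s p%:R) <= \sum_(p./2.+1 <= k < p.+1) u k.
  move=> Pp; have [p1 ap _ _ _] := double_le_bounds _ _ Pp.
  have p0 : 0 < p%:R :> R by rewrite ltr0n.
  have sp0 : 0 < s p%:R by rewrite s_gt0 ?natge.
  apply: (@le_trans _ _ (\sum_(p./2.+1 <= k < p.+1) (p%:R / 2) `^ al / p%:R / s p%:R)).
    rewrite sumr_const_nat -[leRHS]mulr_natr powRM ?(ltW p0) ?invr_ge0 //.
    rewrite powRV // /c powRN gt0_powRD //.
    rewrite powRr1 //.
    apply: (@le_trans _ _ (p%:R `^ al * (2 `^ al)^-1 / p%:R / s p%:R * (p%:R / 2))).
      rewrite le_eqVlt; apply/orP; left; apply/eqP.
      by field; rewrite !gt_eqF ?powR_gt0.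
    rewrite ler_wpM2l ?mulr_ge0 ?invr_ge0 ?powR_ge0 ?(ltW p0) ?(ltW sp0) //.
    by rewrite ler_pdivrMr // -natrM ler_nat upper_half_ge.
  rewrite ler_sum_nat // => k /andP[pk kp].
  have [k1 ak pk2] := half_lt_bounds _ _ _ Pp pk.
  have k0 : 0 < k%:R :> R by rewrite ltr0n.
  have sk0 : 0 < s k%:R by rewrite s_gt0 ?natge.
  (* The sign of [al - 1] is unknown, so [k^al] and [1/k] are bounded separately, by [k >= p/2] and
     [k <= p]. *)
  rewrite /u gt0_powRB //.
  rewrite powRr1 ?(ltW k0) //.
  have kp' : k%:R <= p%:R :> R by rewrite ler_nat.
  rewrite !ler_pM ?mulr_ge0 ?invr_ge0 ?powR_ge0 ?(ltW p0) ?(ltW sp0) //.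
  - rewrite ge0_ler_powR ?nnegrE ?(ltW al_gt0) ?divr_ge0 ?(ltW p0) ?(ltW k0) //.
    by rewrite ler_pdivrMr // -natrM ler_nat.
  - by rewrite lef_pV2 ?posrE.
  - by rewrite lef_pV2 ?posrE // s_nd // ltW.
have Jblock p : (P <= p)%N -> J p = J p./2 + \sum_(p./2.+1 <= k < p.+1) u k.
  move=> Pp; have [_ _ _ h _] := double_le_bounds _ _ Pp.
  by rewrite /J -big_cat_nat //= ltnS -divn2 leq_div.
have J0 p : 0 <= J p by rewrite sumr_ge0.
have c1 : 0 < 1 - c / D < 1.
  by rewrite subr_gt0 ltr_pdivrMr // mul1r ltrDr C0 gtrBl divr_gt0.
apply: (@doubling_growth R s al a s_ge0 s_nd al_gt0 a_ge0 s_gt0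
  (fun p => (J p)^-1) P (1 - c / D) D^-1 c^-1) => //.
- by rewrite invr_gt0.
- by rewrite /P muln_gt0 /A addn1.
have Jbd p : (P <= p)%N -> [/\ 0 < p%:R `^ al / s p%:R,
    c * (p%:R `^ al / s p%:R) <= J p & J p <= D * (p%:R `^ al / s p%:R)].
  move=> Pp; have [p1 ap ap1 _ _] := double_le_bounds _ _ Pp.
  have w0 : 0 < p%:R `^ al / s p%:R.
    by rewrite divr_gt0 ?powR_gt0 ?ltr0n ?s_gt0 ?natge.
  split=> //.
    by apply: (le_trans (block _ Pp)); rewrite (Jblock p Pp) lerDr.
  apply: (le_trans (hC p ap1)).
  by rewrite ler_pM2r // lerDl ltW.
move=> p Pp; have [_ _ _ _ P2] := double_le_bounds _ _ Pp.
have [w0 h1 h2] := Jbd p Pp; have [w20 h3 h4] := Jbd _ P2.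
have Jp0 : 0 < J p by rewrite (lt_le_trans _ h1) // mulr_gt0.
have J2p0 : 0 < J (2 * p)%N by rewrite (lt_le_trans _ h3) // mulr_gt0.
have wE : s p%:R / p%:R `^ al = (p%:R `^ al / s p%:R)^-1 by rewrite invf_div.
split; last first.
  rewrite wE; move: (p%:R `^ al / s p%:R) (J p) w0 h1 h2 Jp0 => w z w0 h1 h2 z0.
  by rewrite -invfM -[c^-1 * _]invfM !lef_pV2 ?posrE ?mulr_gt0 // h1 h2.
rewrite ler_pdivlMr // mulrC ler_pdivrMr //.
rewrite mulrBl mul1r lerBrDr {2}(Jblock _ P2).
rewrite mul2n doubleK.
rewrite lerD2l; have := block _ P2; rewrite mul2n doubleK.
by apply: le_trans; rewrite -mulrA ler_pM2l // ler_pdivrMl // -mul2n.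
Qed.

End SumConditions.

(** * Integral estimates *)

Section Integrals.
Context {R : realType}.
Notation mu := (@lebesgue_measure R).
Implicit Types (f : R -> R) (D : set R).

(** The function [f (max b t)] is monotone on the whole line and agrees with [f] on [D]. *)
Lemma measurable_nondecreasing_on f b D : measurable D -> D `<=` [set t | b <= t] ->
  (forall x y, b <= x -> x <= y -> f x <= f y) -> measurable_fun D f.
Proof.
move=> mD Db f_nd; apply: (@eq_measurable_fun _ _ _ _ _ (fun t => f (Num.max b t))).
  by move=> t /set_mem/Db /= bt; rewrite max_r.
apply: nondecreasing_measurable => // x y xy; apply: f_nd; first by rewrite le_max lexx.
by rewrite ge_max !le_max lexx xy orbT.
Qed.

Lemma measurable_nonincreasing_on f b D : measurable D -> D `<=` [set t | b <= t] ->
  (forall x y, b <= x -> x <= y -> f y <= f x) -> measurable_fun D f.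
Proof.
move=> mD Db f_ni; apply: (@eq_measurable_fun _ _ _ _ _ (fun t => f (Num.max b t))).
  by move=> t /set_mem/Db /= bt; rewrite max_r.
apply: nonincreasing_measurable => // x y xy; apply: f_ni; first by rewrite le_max lexx.
by rewrite ge_max !le_max lexx xy orbT.
Qed.

Lemma cst_le_integral f D (m u v : R) : measurable D -> measurable_fun D f ->
  (forall t, D t -> 0 <= f t) -> 0 <= m -> u <= v -> `[u, v[ `<=` D ->
  (forall t, u <= t < v -> m <= f t) ->
  ((m * (v - u))%:E <= \int[mu]_(t in D) (f t)%:E)%E.
Proof.
move=> mD mf f0 m0 uv uvD mle.
apply: (@le_trans _ _ (\int[mu]_(t in `[u, v[) (f t)%:E)%E); last first.
  by apply: ge0_subset_integral => //; exact/measurable_EFinP.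
have -> : (m * (v - u))%:E = (\int[mu]_(t in `[u, v[) cst m%:E t)%E.
  rewrite integral_cst //= lebesgue_measure_itv /= lte_fin EFinM EFinB.
  by case: ltP => // vu; rewrite (le_anti (introT andP (conj uv vu))) subee // mule0.
apply: ge0_le_integral => //.
by apply/measurable_EFinP; exact: measurable_funS mf.
Qed.

(** The half-open intervals are disjoint and tile [[x p, x n[], so the bounds on single intervals
    add up. *)
Lemma sum_le_integral f (x m : nat -> R) (p n : nat) : (p <= n)%N ->
  (forall k, x k <= x k.+1) -> measurable_fun `[x p, +oo[ f ->
  (forall t, x p <= t -> 0 <= f t) ->
  (forall k, (p <= k)%N ->
    ((m k)%:E <= \int[mu]_(t in `[x k, x k.+1[) (f t)%:E)%E) ->
  ((\sum_(p <= k < n) m k)%:E <= \int[mu]_(t in `[x p, x n[) (f t)%:E)%E.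
Proof.
move=> pn xx mf f0 mle; elim: n pn => [|n IH].
  by rewrite leqn0 => /eqP ->; rewrite big_geq // set_itvco0 integral_set0.
rewrite leq_eqVlt => /predU1P[<-|].
  by rewrite big_geq // set_itvco0 integral_set0.
rewrite ltnS => pn.
have xpn : x p <= x n.
  by elim: n {IH} pn => [|n IHn]; [rewrite leqn0 => /eqP -> |
    rewrite leq_eqVlt => /predU1P[<- //|]; rewrite ltnS => /IHn/le_trans; exact].
have U : `[x p, x n.+1[%classic = `[x p, x n[ `|` `[x n, x n.+1[.
  by apply: itv_bndbnd_setU; rewrite bnd_simp.
rewrite big_nat_recr //= U ge0_integral_setU //=; last 3 first.
- rewrite -U; apply/measurable_EFinP; apply: measurable_funS mf => //.
  by move=> t; rewrite /= !in_itv /= => /andP[->].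
- move=> t /= [] /=; rewrite in_itv /= => /andP[h _]; rewrite lee_fin f0 //.
  exact: le_trans h.
- apply/disj_setPS => t [] /=; rewrite !in_itv /= => /andP[_ tx] /andP[xt _].
  by move: (lt_le_trans tx xt); rewrite ltxx.
by rewrite EFinD leeD ?IH ?mle.
Qed.

(** Monotone convergence; this yields improper integrals from bounds on compact intervals. *)
Lemma bigcup_integral_le f (F : (set R)^nat) (M : R) :
  {homo F : n m / (n <= m)%N >-> (n <= m)%O} -> (forall i, measurable (F i)) ->
  (forall i, measurable_fun (F i) f) -> (forall i t, F i t -> 0 <= f t) ->
  (forall i, (\int[mu]_(t in F i) (f t)%:E <= M%:E)%E) ->
  (\int[mu]_(t in \bigcup_i F i) (f t)%:E <= M%:E)%E.
Proof.
move=> ndF mF mf f0 leM.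
have cv : (\int[mu]_(t in F i) (f t)%:E)%E @[i --> \oo] -->
    (\int[mu]_(t in \bigcup_i F i) (f t)%:E)%E.
  apply: ge0_nondecreasing_set_cvg_integral => //.
  by move=> i; apply/measurable_EFinP; exact: mf.
rewrite -(cvg_lim _ cv) //; apply: lime_le; first exact: cvgP cv.
exact: nearW.
Qed.

Lemma powR_continuous_at (e x : R) : 0 < x -> {for x, continuous (fun t : R => t `^ e)}.
Proof.
move=> x0; apply: differentiable_continuous; apply/derivable1_diffP.
by case: (is_derive1_powR e x0).
Qed.

Lemma integral_powR (e u v : R) : e != 0 -> 0 < u -> u < v ->
  (\int[mu]_(t in `[u, v]) (t `^ (e - 1))%:E = ((v `^ e - u `^ e) / e)%:E)%E.
Proof.
move=> e0 u0 uv; have v0 := lt_trans u0 uv.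
have dF (x : R) : 0 < x ->
    is_derive x 1 (fun t : R => e^-1 * t `^ e) (x `^ (e - 1)).
  move=> x0; have -> : x `^ (e - 1) = e^-1 * (e * x `^ (e - 1)) by rewrite mulKf.
  have := is_derive1_powR e x0 => ?; exact: is_deriveZ.
have cF (x : R) : 0 < x -> {for x, continuous (fun t : R => e^-1 * t `^ e)}.
  move=> x0; apply: differentiable_continuous; apply/derivable1_diffP.
  by case: (dF _ x0).
rewrite (@continuous_FTC2 R _ (fun t => e^-1 * t `^ e)) //.
- by rewrite -EFinB -mulrBr mulrC.
- apply: continuous_in_subspaceT => x /set_mem /=; rewrite in_itv /= => /andP[ux _].
  by apply: powR_continuous_at; exact: lt_le_trans ux.
- split.
  + move=> x; rewrite in_itv /= => /andP[ux _].
    by case: (dF x (lt_trans u0 ux)).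
  + by apply: cvg_at_right_filter; exact: cF.
  + by apply: cvg_at_left_filter; exact: cF.
- move=> x; rewrite in_itv /= => /andP[ux _]; rewrite derive1E.
  by have [_ ->] := dF x (lt_trans u0 ux).
Qed.

Lemma measurable_powR_on (e : R) D : measurable_fun D (fun t : R => t `^ e).
Proof. by apply: measurable_funTS; exact: measurable_powR. Qed.

Lemma integral_powRN_le (d : R) : 0 < d ->
  (\int[mu]_(t in `[1%R, +oo[) (t `^ (- d - 1))%:E <= d^-1%:E)%E.
Proof.
move=> d0; rewrite itv_bndy_bigcup_BRight; apply: bigcup_integral_le => //.
- move=> n m nm; apply/subsetPset => t; rewrite /= !in_itv /= => /andP[-> /le_trans]; apply.
  by rewrite lerD2l ler_nat.
- by move=> i; exact: measurable_powR_on.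
- by move=> i t _; exact: powR_ge0.
(* The first interval is the point 1, where [integral_powR] does not apply since it asks for
   distinct endpoints. *)
move=> [|n].
  by rewrite addr0 set_itv1 integral_set1 lee_fin invr_ge0 ltW.
rewrite integral_powR ?oppr_eq0 ?gt_eqF // ?ltrDl // lee_fin powR1.
rewrite invrN mulrN -mulNr opprB -[leRHS]mul1r ler_pM2r ?invr_gt0 //.
Qed.

Lemma integral0_powR_le (d y : R) : 0 < d -> 0 <= y ->
  (\int[mu]_(t in `[0%R, y]) (t `^ (d - 1))%:E <= (y `^ d / d)%:E)%E.
Proof.
move=> d0; rewrite le_eqVlt => /predU1P[<-|y0].
  by rewrite set_itv1 integral_set1 lee_fin divr_ge0 ?powR_ge0 ?ltW.
rewrite -integral_itv_obnd_cbnd; last by apply/measurable_EFinP; exact: measurable_powR_on.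
(* The primitive is only used away from 0, so the interval is exhausted from the right. *)
have -> : `]0, y]%classic = \bigcup_n `[y / n.+1%:R, y]%classic.
  apply/seteqP; split=> t; rewrite /= ?in_itv /=.
    move=> /andP[t0 ty].
    exists (Num.truncn (y / t)) => //=; rewrite in_itv /= ty andbT.
    rewrite ler_pdivrMr // mulrC -ler_pdivrMr //.
    by have /truncn_itv/andP[_ /ltW] : 0 <= y / t by rewrite divr_ge0 ?ltW.
  move=> [n _] /=; rewrite in_itv /= => /andP[nt ->]; rewrite andbT.
  by apply: lt_le_trans nt; rewrite divr_gt0.
apply: bigcup_integral_le => //.
- move=> n m nm; apply/subsetPset => t; rewrite /= !in_itv /= => /andP[nt ->]; rewrite andbT.
  by apply: le_trans nt; rewrite ler_pM2l // lef_pV2 ?posrE // ler_nat.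
- by move=> i; exact: measurable_powR_on.
- by move=> i t _; exact: powR_ge0.
move=> [|n].
  by rewrite divr1 set_itv1 integral_set1 lee_fin divr_ge0 ?powR_ge0 ?ltW.
rewrite integral_powR ?gt_eqF ?divr_gt0 // ?ltr_pdivrMr ?ltr_pMr ?ltr1n //.
by rewrite lee_fin ler_pM2r ?invr_gt0 // gerBl powR_ge0.
Qed.

End Integrals.

(** * Integral conditions *)

Section IntegralConditions.
Context {R : realType}.
Notation mu := (@lebesgue_measure R).
Variables (s : R -> R) (al : R).
Hypothesis s_ge0 : forall x : R, 0 <= x -> 0 <= s x.
Hypothesis s_nd : forall x y : R, 0 <= x -> x <= y -> s x <= s y.
Hypothesis al_gt0 : 0 < al.

Lemma measurable_dilated_quot (y b : R) : 0 < y -> 0 <= b ->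
  measurable_fun `[b, +oo[ (fun t : R => s (y * t) / t `^ (1 + al)).
Proof.
move=> y0 b0; apply: (@eq_measurable_fun _ _ _ _ _
  ((fun t => s (y * t)) \* (fun t => t `^ (- (1 + al))))).
  by move=> t _ /=; rewrite powRN.
apply: measurable_funM; last exact: measurable_powR_on.
apply: (@measurable_nondecreasing_on _ _ b) => //.
  by move=> t; rewrite /= in_itv /= andbT.
move=> u v bu uv; have u0 := le_trans b0 bu.
by apply: s_nd; rewrite ?mulr_ge0 ?(ltW y0) // ler_pM2l.
Qed.

(** The hypothesis has [s y + 1] on the right and holds for all [y > 0], so no positivity threshold
    enters; it serves both [s] and the concave function equivalent to it. *)
Lemma integral_cond_of_growth (gam C : R) : gam < al -> 0 < C ->
  (forall y t, 0 < y -> 1 <= t -> s (y * t) <= C * t `^ gam * (s y + 1)) ->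
  integral_cond s al.
Proof.
move=> gamal C0 sC; have d0 : 0 < al - gam by rewrite subr_gt0.
exists (C / (al - gam)); rewrite divr_gt0 //; split=> // y y0.
have sy0 := s_ge0 _ (ltW y0).
have K0 : 0 <= C * (s y + 1) by rewrite mulr_ge0 ?(ltW C0) // addr_ge0.
apply: (@le_trans _ _ (\int[mu]_(t in `[1%R, +oo[)
    ((C * (s y + 1))%:E * (t `^ (- (al - gam) - 1))%:E))%E).
  apply: ge0_le_integral => //.
  - move=> t; rewrite /= in_itv /= andbT => t1.
    by rewrite lee_fin divr_ge0 ?powR_ge0 ?s_ge0 // mulr_ge0 ?(ltW y0) // (le_trans ler01).
  - by apply/measurable_EFinP; exact: measurable_dilated_quot.
  - apply/measurable_EFinP; apply: measurable_funM; first exact: measurable_cst.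
    exact: measurable_powR_on.
  move=> t; rewrite /= in_itv /= andbT => t1; have t0 : 0 < t := lt_le_trans ltr01 t1.
  have -> : - (al - gam) - 1 = gam - (1 + al) by ring.
  rewrite -EFinM lee_fin gt0_powRB // mulrA ler_wpM2r ?invr_ge0 ?powR_ge0 //.
  by rewrite mulrAC sC.
rewrite ge0_integralZl_EFin //; last 2 first.
- by move=> t _; rewrite lee_fin powR_ge0.
- by apply/measurable_EFinP; exact: measurable_powR_on.
apply: (@le_trans _ _ ((C * (s y + 1))%:E * ((al - gam)^-1)%:E)%E).
  by rewrite lee_wpmul2l ?lee_fin // integral_powRN_le.
by rewrite -EFinM lee_fin le_eqVlt; apply/orP; left; apply/eqP; ring.
Qed.

Variable a : R.
Hypothesis a_ge0 : 0 <= a.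
Hypothesis s_gt0 : forall x, a <= x -> 0 < s x.
Let hub := exists2 gam : R, 0 < gam < al & power_growth s a gam.
Let natge p (ap : (ceiln a <= p)%N) : a <= p%:R := @ceiln_ge R a p a_ge0 ap.

(** Below [b = max a 1], monotonicity replaces [y] by [b], and the summand 1 next to [s y] absorbs
    the constant [s b]. *)
Lemma growth_affine gam : power_growth s a gam -> exists C, 0 < C /\
  forall y t, 0 < y -> 1 <= t -> s (y * t) <= C * t `^ gam * (s y + 1).
Proof.
move=> [C [C0 sC]]; pose b := Num.max a 1.
have b0 : 0 < b by rewrite lt_max ltr01 orbT.
have ab : a <= b by rewrite le_max lexx.
have sb0 : 0 < s b by rewrite s_gt0.
exists (C * (1 + s b)); rewrite mulr_gt0 ?addr_gt0 //; split=> // y t y0 t1.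
have sy0 := s_ge0 _ (ltW y0); have t0 := lt_le_trans ltr01 t1.
have Ct : 0 <= C * t `^ gam by rewrite mulr_ge0 ?powR_ge0 ?(ltW C0).
rewrite (_ : _ * (s y + 1) = C * t `^ gam * ((1 + s b) * (s y + 1))); last by ring.
have [yb|/ltW yb] := leP b y.
  rewrite mulrC; apply: (le_trans (sC y t (le_trans ab yb) y0 t1)).
  by rewrite ler_wpM2l //; nra.
apply: (@le_trans _ _ (s (t * b))).
  by rewrite s_nd ?mulr_ge0 ?(ltW y0) ?(ltW t0) // mulrC ler_pM2l.
apply: (le_trans (sC b t ab b0 t1)); rewrite ler_wpM2l //; nra.
Qed.

Lemma growth_integral_cond : hub -> integral_cond s al.
Proof.
move=> [gam /andP[_ gamal] /growth_affine[C [C0 sC]]].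
exact: integral_cond_of_growth sC.
Qed.

(** At [y = p] the integral is cut at the points [k/p]; up to a constant and the factor [p^al], the
    piece starting at [k/p] dominates the term of index [k]. *)
Lemma integral_cond_tail_sum : integral_cond s al ->
  exists C : R, 0 < C /\ forall p : nat, (1 <= p)%N -> (ceiln a <= p)%N ->
  (\sum_(p <= k <oo) ((s k%:R / k%:R `^ (1 + al))%R%:E)
    <= (C * (s p%:R / p%:R `^ al))%R%:E)%E.
Proof.
move=> [C [C0 hC]]; have sa0 : 0 < s a by rewrite s_gt0.
pose c := 2 `^ (- (1 + al)) : R; have c0 : 0 < c by rewrite powR_gt0.
(* The summand [1/s a] absorbs the additive [C], because [s p >= s a]; the factor [1/c] repays the
   comparison of terms with integrals. *)
exists (C * (1 + (s a)^-1) / c); split.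
  by rewrite divr_gt0 // mulr_gt0 // addr_gt0 ?invr_gt0.
move=> p p1 ap; have p0 : 0 < p%:R :> R by rewrite ltr0n.
have ap' := natge _ ap; have pal : 0 < (p%:R : R) `^ al by rewrite powR_gt0.
apply: lime_le.
  apply: is_cvg_nneseries => n _ _.
  by rewrite lee_fin divr_ge0 ?powR_ge0 ?s_ge0.
apply: nearW => n; rewrite sumEFin lee_fin.
have sasp : s a <= s p%:R by exact: s_nd.
have sp0 := lt_le_trans sa0 sasp.
have [np|/ltnW pn] := leqP n p.
  rewrite big_geq // !mulr_ge0 ?invr_ge0 ?(ltW c0) ?(ltW C0) ?(ltW pal) ?(ltW sp0) //.
  by rewrite addr_ge0 // invr_ge0 ltW.
pose f t := s (p%:R * t) / t `^ (1 + al).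
pose x (k : nat) : R := k%:R / p%:R.
have xp : x p = 1 by rewrite /x divff ?gt_eqF.
have mf : measurable_fun (`[1, +oo[%classic : set R) f by exact: measurable_dilated_quot.
have f0 t : 1 <= t -> 0 <= f t.
  move=> t1; rewrite divr_ge0 ?powR_ge0 ?s_ge0 // mulr_ge0 ?(ltW p0) //.
  exact: le_trans t1.
have le_int : ((\sum_(p <= k < n) (c * p%:R `^ al * (s k%:R / k%:R `^ (1 + al))))%:E <=
    \int[mu]_(t in `[x p, x n[) (f t)%:E)%E.
  apply: sum_le_integral => //.
  - by move=> k; rewrite ler_pM2r ?invr_gt0 // ler_nat.
  - by rewrite xp.
  - by rewrite xp.
  move=> k pk; have k0 : 0 < k%:R :> R by rewrite ltr0n (leq_trans p1 pk).
  have xk1 : 1 <= x k by rewrite /x ler_pdivlMr // mul1r ler_nat.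
  have xkS : x k <= x k.+1 by rewrite ler_pM2r ?invr_gt0 // ler_nat.
  (* On [[k/p, (k+1)/p[] one has [s (p t) >= s k], and [t <= 2k/p] because [k >= 1]; hence [m]
     bounds the integrand from below. *)
  pose m := s k%:R / (2 * x k) `^ (1 + al).
  have -> : c * p%:R `^ al * (s k%:R / k%:R `^ (1 + al)) = m * (x k.+1 - x k).
    rewrite (_ : x k.+1 - x k = p%:R^-1) /m /x; last first.
      by rewrite -mulrBl -natr1 addrAC subrr add0r mul1r.
    rewrite mulrA powRM ?invr_ge0 ?mulr_ge0 // powRM // powRV //.
    rewrite /c powRN !(gt0_powRD p%:R) // powRr1 //.
    by field; rewrite !gt_eqF ?powR_gt0.
  apply: cst_le_integral => //.
  - apply: measurable_funS mf => // t; rewrite /= !in_itv /= => /andP[h _].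
    by rewrite (le_trans xk1).
  - by move=> t; rewrite /= in_itv /= => /andP[h _]; rewrite f0 // (le_trans xk1).
  - by rewrite divr_ge0 ?powR_ge0 ?s_ge0.
  move=> t /andP[xt tx]; have t0 : 0 < t by rewrite (lt_le_trans ltr01) // (le_trans xk1).
  rewrite ler_pM ?s_ge0 ?invr_ge0 ?powR_ge0 //.
    by rewrite s_nd // mulrC -ler_pdivrMr.
  have x20 : 0 < 2 * x k by rewrite pmulr_rgt0 // (lt_le_trans ltr01).
  rewrite lef_pV2 ?posrE ?powR_gt0 // ge0_ler_powR ?nnegrE ?(ltW t0) ?(ltW x20) //.
    by rewrite addr_ge0 // ltW.
  apply: (le_trans (ltW tx)); rewrite /x mulrA ler_pM2r; last by rewrite invr_gt0.
  rewrite -natrM ler_nat mul2n -addnn.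
  by rewrite -addn1 leq_add2l (leq_trans p1 pk).
have : ((\sum_(p <= k < n) (c * p%:R `^ al * (s k%:R / k%:R `^ (1 + al))))%:E <=
    (C * s p%:R + C)%:E)%E.
  apply: (le_trans le_int); apply: le_trans (hC _ p0).
  apply: ge0_subset_integral => //.
  - exact/measurable_EFinP.
  - by move=> t; rewrite /= in_itv /= andbT => /f0; rewrite lee_fin.
  - by move=> t; rewrite xp /= !in_itv /= => /andP[->].
rewrite lee_fin -mulr_sumr -ler_pdivlMl ?mulr_gt0 // => /le_trans; apply.
rewrite (_ : _^-1 * _ = (C * s p%:R + C) / c / p%:R `^ al); last by field; rewrite !gt_eqF.
rewrite (_ : C * (1 + (s a)^-1) / c * (s p%:R / p%:R `^ al) =
  (C * s p%:R + C * (s p%:R / s a)) / c / p%:R `^ al); last by ring.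
rewrite ler_pM2r ?invr_gt0 // ler_pM2r ?invr_gt0 // lerD2l ler_peMr ?(ltW C0) //.
by rewrite ler_pdivlMr // mul1r.
Qed.

Lemma measurable_powR_quot : measurable_fun `[a, +oo[ (fun t : R => t `^ al / s t / t).
Proof.
apply: (@eq_measurable_fun _ _ _ _ _
  (((fun t => t `^ al) \* (fun t => (s t)^-1)) \* (fun t => t `^ (-1)))).
  move=> t /set_mem; rewrite /= in_itv /= andbT => at_.
  by rewrite powR_inv1 // (le_trans a_ge0).
apply: measurable_funM; last exact: measurable_powR_on.
apply: measurable_funM; first exact: measurable_powR_on.
apply: (@measurable_nonincreasing_on _ _ a) => //.
  by move=> t; rewrite /= in_itv /= andbT.
move=> u v au uv; rewrite lef_pV2 ?posrE ?s_gt0 //; last exact: le_trans uv.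
by apply: s_nd => //; exact: le_trans au.
Qed.

(** Power growth from [t] to [y] bounds [1/s t] by [C (y/t)^gam / s y], leaving the integral of
    [t^(al - gam - 1)], which converges at 0. *)
Lemma growth_integral_le : hub -> exists C : R, 0 < C /\ forall y : R, a <= y ->
  (\int[mu]_(t in `[a, y]) ((t `^ al / s t / t)%R%:E) <= (C * y `^ al / s y)%R%:E)%E.
Proof.
move=> [gam /andP[gam0 gamal] [C [C0 sC]]].
have d0 : 0 < al - gam by rewrite subr_gt0.
exists (C / (al - gam)); rewrite divr_gt0 //; split=> // y ay.
have y0 := le_trans a_ge0 ay; have sy0 := s_gt0 _ ay.
have K0 : 0 <= C * y `^ gam / s y.
  by rewrite !mulr_ge0 ?invr_ge0 ?powR_ge0 ?(ltW C0) ?(ltW sy0).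
apply: (@le_trans _ _ (\int[mu]_(t in `[a, y])
    ((C * y `^ gam / s y)%:E * (t `^ (al - gam - 1))%:E))%E).
  apply: ge0_le_integral => //.
  - move=> t; rewrite /= in_itv /= => /andP[at_ ty]; have t0 := le_trans a_ge0 at_.
    by rewrite lee_fin !mulr_ge0 ?invr_ge0 ?powR_ge0 ?s_ge0.
  - apply/measurable_EFinP; apply: measurable_funS measurable_powR_quot => //.
    by move=> t; rewrite /= !in_itv /= => /andP[->].
  - apply/measurable_EFinP; apply: measurable_funM; first exact: measurable_cst.
    exact: measurable_powR_on.
  move=> t; rewrite /= in_itv /= => /andP[at_ ty]; have := le_trans a_ge0 at_.
  (* The point [t = 0] occurs when [a = 0]; there the inverse of 0 is 0 and the integrand
     vanishes. *)
  rewrite -EFinM lee_fin le_eqVlt => /predU1P[<-|t0].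
    by rewrite invr0 mulr0 mulr_ge0 ?powR_ge0.
  have st0 := s_gt0 _ at_; have h := growth_quot s a gam C t y sC at_ t0 ty.
  have -> : al - gam - 1 = al - 1 - gam by ring.
  rewrite !gt0_powRB // powRr1 ?(ltW t0) //.
  have tg : 0 < t `^ gam by rewrite powR_gt0.
  have -> : C * y `^ gam / s y * (t `^ al / t / t `^ gam) =
    t `^ al / s t / t * (C * (y `^ gam / t `^ gam) * s t / s y).
    by field; rewrite !gt_eqF.
  rewrite ler_peMr //; last by rewrite ler_pdivlMr // mul1r.
  by rewrite !mulr_ge0 ?invr_ge0 ?powR_ge0 ?(ltW st0) ?(ltW t0).
rewrite ge0_integralZl_EFin //; last 2 first.
- by move=> t _; rewrite lee_fin powR_ge0.
- by apply/measurable_EFinP; exact: measurable_powR_on.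
apply: (@le_trans _ _ ((C * y `^ gam / s y)%:E * (y `^ (al - gam) / (al - gam))%:E)%E).
  rewrite lee_wpmul2l ?lee_fin //; apply: le_trans (integral0_powR_le _ _ d0 y0).
  apply: ge0_subset_integral => //.
  - by apply/measurable_EFinP; exact: measurable_powR_on.
  - by move=> t _; rewrite lee_fin powR_ge0.
  - move=> t; rewrite /= !in_itv /= => /andP[at_ ->].
    by rewrite (le_trans a_ge0).
rewrite -EFinM lee_fin.
have -> : y `^ al = y `^ gam * y `^ (al - gam).
  by rewrite -powRD; [rewrite addrC subrK | rewrite addrC subrK gt_eqF].
by rewrite le_eqVlt; apply/orP; left; apply/eqP; ring.
Qed.

(** The term of index [k] is compared with the integral over [[k-1, k[]. As the sum starts at
    [ceiln a + 1], the first such interval starts at [ceiln a], hence not before [a]. *)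
Lemma integral_le_sum_le : (exists C : R, 0 < C /\ forall y : R, a <= y ->
  (\int[mu]_(t in `[a, y]) ((t `^ al / s t / t)%R%:E) <= (C * y `^ al / s y)%R%:E)%E) ->
  exists C : R, 0 < C /\ forall p : nat, (ceiln a + 1 <= p)%N ->
  \sum_(ceiln a + 1 <= k < p.+1) k%:R `^ (al - 1) / s k%:R
    <= C * (p%:R `^ al / s p%:R).
Proof.
move=> [C [C0 hC]]; pose c := 2 `^ (- (1 + al)) : R; have c0 : 0 < c by rewrite powR_gt0.
exists (C / c); rewrite divr_gt0 //; split=> // p ap.
have ap' : a <= p%:R by rewrite natge // (leq_trans (leq_addr 1 _) ap).
pose f t := t `^ al / s t / t; pose x (k : nat) : R := k%:R - 1.
have xA : a <= x (ceiln a + 1)%N by rewrite /x natrD addrK natge.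
have f0 t : a <= t -> 0 <= f t.
  move=> at_; have t0 := le_trans a_ge0 at_.
  by rewrite !mulr_ge0 ?invr_ge0 ?powR_ge0 ?s_ge0.
have mfD b y : a <= b -> measurable_fun [set` Interval (BLeft b) y] f.
  move=> ab; apply: measurable_funS measurable_powR_quot => // t.
  rewrite /= !in_itv /= => /andP[bt _].
  by rewrite (le_trans ab).
have le_int : ((\sum_(ceiln a + 1 <= k < p.+1) (c * (k%:R `^ (al - 1) / s k%:R)))%:E <=
    \int[mu]_(t in `[x (ceiln a + 1)%N, x p.+1[) (f t)%:E)%E.
  apply: sum_le_integral => //.
  - exact: leq_trans ap (leqnSn _).
  - by move=> k; rewrite lerD2r ler_nat.
  - exact: mfD.
  - by move=> t h; apply: f0; exact: le_trans h.
  move=> k ak; have k0 : 0 < k%:R :> R by rewrite ltr0n (leq_trans _ ak) // addn1.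
  have axk : a <= x k by apply: (le_trans xA); rewrite lerD2r ler_nat.
  have ak' : a <= k%:R by rewrite natge // (leq_trans (leq_addr 1 _) ak).
  have xS : x k.+1 = k%:R by rewrite /x -natr1 addrK.
  have sk0 := s_gt0 _ ak'.
  pose m := (k%:R / 2) `^ al / s k%:R / k%:R.
  have -> : c * (k%:R `^ (al - 1) / s k%:R) = m * (k%:R - (k%:R - 2^-1)).
    rewrite /m /c powRM ?invr_ge0 ?(ltW k0) // powRV // powRN (gt0_powRD 2) //.
    rewrite gt0_powRB // !powRr1 ?(ltW k0) //.
    by field; rewrite !gt_eqF ?powR_gt0.
  (* Only the right half of [[k-1, k[] is used: there [t >= k/2], while for [k = 1] the whole
     interval reaches 0, where [t^al] vanishes. The half length is the extra factor 2 in [c]. *)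
  have xh : x k <= k%:R - 2^-1 by rewrite /x lerD2l lerN2 invf_le1 ?ler1n.
  rewrite xS; apply: cst_le_integral => //.
  - exact: mfD.
  - by move=> t; rewrite /= in_itv /= => /andP[h _]; apply: f0; exact: le_trans h.
  - by rewrite !mulr_ge0 ?invr_ge0 ?powR_ge0 ?(ltW k0) ?(ltW sk0).
  - by rewrite gerBl invr_ge0.
  - move=> t; rewrite /= !in_itv /= => /andP[h ->]; rewrite andbT.
    exact: le_trans h.
  move=> t /andP[ht tk]; have k1 : 1 <= k%:R :> R by rewrite ler1n -(ltr0n R).
  have t0 : 0 < t by lra.
  have at_ : a <= t by rewrite (le_trans axk) // (le_trans xh).
  have st0 := s_gt0 _ at_.
  rewrite !ler_pM ?mulr_ge0 ?invr_ge0 ?powR_ge0 ?(ltW k0) ?(ltW sk0) //.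
  - rewrite ge0_ler_powR ?nnegrE ?(ltW al_gt0) ?divr_ge0 ?(ltW k0) ?(ltW t0) //.
    lra.
  - by rewrite lef_pV2 ?posrE // s_nd ?(ltW t0) ?(ltW tk).
  - by rewrite lef_pV2 ?posrE // ltW.
have : ((\sum_(ceiln a + 1 <= k < p.+1) (c * (k%:R `^ (al - 1) / s k%:R)))%:E <=
    (C * p%:R `^ al / s p%:R)%:E)%E.
  apply: (le_trans le_int); apply: le_trans (hC _ ap').
  apply: ge0_subset_integral => //.
  - by apply/measurable_EFinP; exact: mfD.
  - by move=> t; rewrite /= in_itv /= => /andP[/f0 h _]; rewrite lee_fin.
  - move=> t; rewrite /= !in_itv /= => /andP[h]; rewrite /x -natr1 addrK => /ltW ->.
    by rewrite (le_trans xA).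
rewrite lee_fin -mulr_sumr -ler_pdivlMl // => /le_trans; apply.
by rewrite le_eqVlt; apply/orP; left; apply/eqP; ring.
Qed.

End IntegralConditions.

(** * Least concave majorant *)

Section ConcaveMajorant.
Context {R : realType}.
Variable f : R -> R.

(** A pair is an intercept and a slope. Their signs keep the infimum below bounded by 0 from below
    and make it nondecreasing on the half-line. *)
Definition affine_majorants : set (R * R) :=
  [set p | [/\ 0 <= p.1, 0 <= p.2 & forall v, 0 <= v -> f v <= p.1 + p.2 * v]].

Definition concave_majorant (u : R) : R :=
  inf [set p.1 + p.2 * u | p in affine_majorants].

Lemma concave_majorant_le p u : affine_majorants p -> 0 <= u ->
  concave_majorant u <= p.1 + p.2 * u.
Proof.
move=> hp u0; apply: ge_inf; last by exists p.
by exists 0 => _ [q [q1 q2 _] <-]; rewrite addr_ge0 ?mulr_ge0.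
Qed.

Lemma le_concave_majorant c u : affine_majorants !=set0 ->
  (forall p, affine_majorants p -> c <= p.1 + p.2 * u) -> c <= concave_majorant u.
Proof.
move=> [p hp] h; apply: lb_le_inf; first by exists (p.1 + p.2 * u), p.
by move=> _ [q hq <-]; exact: h.
Qed.

Hypothesis majorized : affine_majorants !=set0.

Lemma concave_majorant_ge u : 0 <= u -> f u <= concave_majorant u.
Proof. by move=> u0; apply: le_concave_majorant => // p [_ _]; apply. Qed.

Lemma concave_majorant_nd u v : 0 <= u -> u <= v ->
  concave_majorant u <= concave_majorant v.
Proof.
move=> u0 uv; apply: le_concave_majorant => // p hp.
apply: (le_trans (concave_majorant_le _ _ hp u0)); rewrite lerD2l.
by have [_ p2 _] := hp; rewrite ler_wpM2l.
Qed.

Lemma concave_majorant_concave : concave_nonneg concave_majorant.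
Proof.
move=> x y l x0 y0 /andP[l0 l1]; apply: le_concave_majorant => // p hp.
have hx := concave_majorant_le _ _ hp x0; have hy := concave_majorant_le _ _ hp y0.
have l1' : 0 <= 1 - l by rewrite subr_ge0.
apply: (le_trans (lerD (ler_wpM2l l0 hx) (ler_wpM2l l1' hy))).
by rewrite le_eqVlt; apply/orP; left; apply/eqP; ring.
Qed.

End ConcaveMajorant.

(** Since 0 is an extreme point of the half-line, a convex combination equals 0 only if every point
    of nonzero weight is 0. For all other combinations the right side is unchanged and the left side
    can only drop. *)
Lemma concave_nonneg_lower_at0 {R : realType} (g : R -> R) (c : R) :
  concave_nonneg g -> c <= g 0 ->
  concave_nonneg (fun t => if t == 0 then c else g t).
Proof.
move=> gc c0 x y l x0 y0 l01; have [l0 l1] := andP l01.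
have l1' : 0 <= 1 - l by rewrite subr_ge0.
have le_g t : (if t == 0 then c else g t) <= g t by case: eqP => [->|].
case: (l * x + (1 - l) * y =P 0) => [|_]; last first.
  apply: le_trans (gc x y l x0 y0 l01).
  by rewrite lerD ?ler_wpM2l.
move/eqP; rewrite paddr_eq0 ?mulr_ge0 // !mulf_eq0 subr_eq0 => /andP[lx ly].
have [l00|l00] := eqVneq l 0.
  move: ly; rewrite l00 oner_eq0 /= => ->.
  by rewrite mul0r add0r subr0 mul1r.
move: lx; rewrite (negPf l00) /= => ->.
have [<-|l10] := eqVneq 1 l; first by rewrite subrr mul0r addr0 mul1r.
by move: ly; rewrite (negPf l10) /= => ->; rewrite -mulrDl addrC subrK mul1r.
Qed.

(** * The equivalent function that is concave after a change of variable *)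

Section ConcaveEquivalent.
Context {R : realType}.
Variables (s : R -> R) (al a : R).
Hypothesis s_ge0 : forall x : R, 0 <= x -> 0 <= s x.
Hypothesis s_nd : forall x y : R, 0 <= x -> x <= y -> s x <= s y.
Hypothesis al_gt0 : 0 < al.
Hypothesis a_ge0 : 0 <= a.
Hypothesis s_gt0 : forall x, a <= x -> 0 < s x.

Let hub := exists2 gam : R, 0 < gam < al & power_growth s a gam.
Let f u := s (u `^ al^-1).

(** Beyond [u], power growth gives the factor [(v/u)^(gam/al)], at most [v/u] because [gam < al]; up
    to [u] the intercept suffices. At [u] itself the line takes the value [(2C + 1)(f u + 1)], so
    the least concave majorant is comparable to [f + 1]. *)
Lemma growth_majorant gam C u : 0 < gam < al -> 0 < C ->
  (forall y t, 0 < y -> 1 <= t -> s (y * t) <= C * t `^ gam * (s y + 1)) ->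
  0 < u -> affine_majorants f ((C + 1) * (f u + 1), C * (f u + 1) / u).
Proof.
move=> /andP[gam0 gamal] C0 sC u0; have u0' := ltW u0.
have fu0 : 0 <= f u by rewrite s_ge0 ?powR_ge0.
have D0 : 0 <= C * (f u + 1) by rewrite mulr_ge0 ?(ltW C0) ?addr_ge0.
split=> /=.
- by rewrite mulr_ge0 ?addr_ge0 ?(ltW C0).
- by rewrite divr_ge0.
move=> v v0; have [vu|/ltW uv] := leP v u.
  apply: (@le_trans _ _ (f u)).
    by rewrite s_nd ?powR_ge0 // ge0_ler_powR ?nnegrE // invr_ge0 ltW.
  have : 0 <= C * (f u + 1) / u * v by rewrite mulr_ge0 ?divr_ge0.
  move: D0; nra.
have vu1 : 1 <= v / u by rewrite ler_pdivlMr // mul1r.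
have t1 : 1 <= (v / u) `^ al^-1 by rewrite ge1_powR // invr_ge0 ltW.
have := sC (u `^ al^-1) _ (powR_gt0 _ u0) t1.
rewrite -powRM ?divr_ge0 // mulrC divfK ?gt_eqF // -/(f v) => /le_trans; apply.
rewrite -/(f u) -powRrM.
have tv : (v / u) `^ (al^-1 * gam) <= v / u.
  rewrite -[leRHS]powRr1 ?divr_ge0 // ler_powR //.
  by rewrite ler_pdivrMl // mulr1 ltW.
have -> : C * (f u + 1) / u * v = C * (v / u) * (f u + 1) by ring.
apply: (@le_trans _ _ (C * (v / u) * (f u + 1))).
  by rewrite ler_wpM2r ?addr_ge0 // ler_pM2l.
by rewrite lerDr mulr_ge0 ?addr_ge0 ?(ltW C0).
Qed.

Lemma growth_concave_equivalent : hub -> exists kappa : R -> R,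
  (forall x, 0 <= x -> 0 <= kappa x) /\
  (forall x y, 0 <= x -> x <= y -> kappa x <= kappa y) /\
  sim_on `[0%R, +oo[ s kappa /\
  kappa 0 = s 0 / al ^+ 2 /\
  integral_cond kappa al /\
  concave_nonneg (fun t => kappa (t `^ al^-1)).
Proof.
move=> [gam gam_int sgam]; have [gam0 gamal] := andP gam_int.
have [C [C0 sC]] := growth_affine s s_ge0 s_nd a s_gt0 gam sgam.
have maj u (u0 : 0 < u) := growth_majorant gam C u gam_int C0 sC u0.
have ne : affine_majorants f !=set0 by exists ((C + 1) * (f 1 + 1), C * (f 1 + 1) / 1); exact: maj.
have al2 : 0 < al ^+ 2 by rewrite exprn_gt0.
have fal x : 0 <= x -> f (x `^ al) = s x.
  by move=> x0; rewrite /f -powRrM divff ?gt_eqF // powRr1.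
have f_0 : f 0 = s 0 by rewrite /f powR0 // invr_eq0 gt_eqF.
(* The majorant may exceed [s 0] at 0, so its value there is lowered to meet the prescribed
   [kappa 0]. *)
pose g t := if t == 0 then s 0 else concave_majorant f t.
pose kappa x := g (x `^ al) / al ^+ 2.
have g_ge t : 0 <= t -> f t <= g t.
  by rewrite /g; case: eqP => [->|_ t0]; [rewrite f_0 | exact: concave_majorant_ge].
have g_le t : 0 <= t -> g t <= (2 * C + 1) * (f t + 1).
  rewrite /g le_eqVlt => /predU1P[<-|t0].
    by rewrite eqxx f_0; have := s_ge0 0 (lexx _); nra.
  rewrite gt_eqF //; apply: (le_trans (concave_majorant_le _ _ _ (maj t t0) (ltW t0))) => /=.
  by rewrite divfK ?gt_eqF // le_eqVlt; apply/orP; left; apply/eqP; ring.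
have k_ge x : 0 <= x -> s x <= al ^+ 2 * kappa x.
  move=> x0; rewrite /kappa mulrC divfK ?gt_eqF //.
  by rewrite -(fal x) // g_ge ?powR_ge0.
have [D D0 k_le] : exists2 D : R, 0 < D & forall x, 0 <= x -> kappa x <= D * (s x + 1).
  exists ((2 * C + 1) / al ^+ 2); first by rewrite divr_gt0 // addr_gt0 ?mulr_gt0.
  move=> x x0; rewrite /kappa mulrAC ler_pM2r ?invr_gt0 //.
  by apply: (le_trans (g_le _ (powR_ge0 _ _))); rewrite fal.
have k_ge0 x : 0 <= x -> 0 <= kappa x.
  move=> x0; rewrite -(pmulr_rge0 _ al2); exact: le_trans (s_ge0 _ x0) (k_ge _ x0).
have k_nd x y : 0 <= x -> x <= y -> kappa x <= kappa y.
  move=> x0 xy; rewrite /kappa ler_pM2r ?invr_gt0 //.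
  have xyal : x `^ al <= y `^ al.
    by rewrite ge0_ler_powR ?nnegrE ?(ltW al_gt0) // (le_trans x0).
  rewrite /g; case: eqP => [x_0|/eqP x_0].
    case: eqP => [//|_]; rewrite -f_0; apply: (le_trans (concave_majorant_ge _ ne _ (lexx 0))).
    by apply: concave_majorant_nd => //; exact: powR_ge0.
  rewrite gt_eqF; last by rewrite (lt_le_trans _ xyal) // lt_neqAle eq_sym x_0 powR_ge0.
  by apply: concave_majorant_nd => //; exact: powR_ge0.
exists kappa; split=> //; split=> //; split; [|split; [|split]].
- exists (1 + al ^+ 2 + D); split; first by rewrite -addrA lerDl addr_ge0 ?ltW.
  move=> t; rewrite /= in_itv /= andbT => t0.
  have := s_ge0 _ t0; have := k_ge _ t0; have := k_le _ t0; have := k_ge0 _ t0.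
  move: (s t) (kappa t) => st kt kt0 kle kge st0.
  have M0 : 0 < 1 + al ^+ 2 + D by rewrite !addr_gt0.
  split; last by nra.
  rewrite lerBlDr ler_pdivrMl //; apply: (le_trans kle); nra.
- by rewrite /kappa /g powR0 ?eqxx // gt_eqF.
(* The constant comes from the chain [kappa (y t) <= D (s (y t) + 1) <= D (C + 1) t^gam (s y + 1)]
   and [s y <= al^2 kappa y]. *)
- apply: (@integral_cond_of_growth _ kappa al k_ge0 k_nd gam (D * (C + 1) * (al ^+ 2 + 1))) => //.
    have [C1 A1] : 0 < C + 1 /\ 0 < al ^+ 2 + 1 by rewrite !addr_gt0.
    exact: mulr_gt0 (mulr_gt0 D0 C1) A1.
  move=> y t y0 t1; have yt0 : 0 <= y * t by rewrite mulr_ge0 ?(ltW y0) ?(le_trans ler01).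
  apply: (le_trans (k_le _ yt0)); rewrite -!mulrA ler_pM2l //.
  have T1 : 1 <= t `^ gam by rewrite ge1_powR // ltW.
  have sy0 := s_ge0 _ (ltW y0); have ky := k_ge _ (ltW y0).
  have k0 := k_ge0 _ (ltW y0).
  have T0 := le_trans ler01 T1.
  apply: (@le_trans _ _ ((C + 1) * (t `^ gam * (s y + 1)))).
    have := sC y t y0 t1; have : 1 <= t `^ gam * (s y + 1) by nra.
    rewrite -mulrA; move: (t `^ gam * (s y + 1)) => X; lra.
  rewrite ler_pM2l ?addr_gt0 // [leRHS]mulrCA ler_wpM2l //; move: ky al2; nra.
- move=> x y l x0 y0 l01.
  have kE t : 0 <= t -> kappa (t `^ al^-1) = g t / al ^+ 2.
    by move=> t0; rewrite /kappa -powRrM mulVf ?gt_eqF // powRr1.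
  have [l0 l1] := andP l01.
  rewrite !kE ?addr_ge0 ?mulr_ge0 ?subr_ge0 // !mulrA -mulrDl ler_pM2r ?invr_gt0 //.
  apply: concave_nonneg_lower_at0 => //; first exact: concave_majorant_concave.
  by rewrite -f_0; apply: concave_majorant_ge.
Qed.

Hypothesis s_oo : s x @[x --> +oo] --> +oo.

(** The integral condition gives power growth of [kappa] through the tail sums. It passes to [s] at
    large [t], where [s t >= C] absorbs the additive constants of [sim_on]. *)
Lemma concave_equivalent_growth kappa :
  (forall x, 0 <= x -> 0 <= kappa x) ->
  (forall x y, 0 <= x -> x <= y -> kappa x <= kappa y) ->
  sim_on `[0%R, +oo[ s kappa -> integral_cond kappa al -> hub.
Proof.
move=> k_ge0 k_nd [C [C1 hC]] ik; have C0 := lt_le_trans ltr01 C1.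
have s_large M b : exists T, b <= T /\ forall t, T <= t -> M <= s t.
  by apply: near_pinfty_geP; move/cvgryPge : s_oo; exact.
have k_up t : 0 <= t -> s t <= C * kappa t + C.
  by move=> t0; have [|_] := hC t; rewrite //= in_itv /= t0.
have k_lo t : 0 <= t -> kappa t <= C * (s t + C).
  move=> t0; have [|+ _] := hC t; first by rewrite //= in_itv /= t0.
  by rewrite lerBlDr ler_pdivrMl.
have [b [b0 hb]] := s_large (C + 1) 0.
have k_gt0 x : b <= x -> 0 < kappa x.
  move=> bx; have x0 := le_trans b0 bx.
  rewrite -(pmulr_rgt0 _ C0) -(ltrD2r C) add0r (lt_le_trans _ (k_up _ x0)) //.
  by rewrite (lt_le_trans _ (hb _ bx)) // ltrDl.
have [gam /andP[gam0 gamal] [C2 [C20 kC]]] := tail_sum_growth kappa al b k_ge0 k_nd al_gt0 b0 k_gt0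
  (integral_cond_tail_sum kappa al k_ge0 k_nd al_gt0 b b0 k_gt0 ik).
have d0 : 0 < al - gam by rewrite subr_gt0.
(* Going from [s] to [kappa] costs a factor [C], and going back costs [2 C]; the last 1 pays for the
   additive [C <= s t <= K^gam s t]. *)
have [K K1 MK] := @powR_gt_exists R _ (2 * C ^+ 2 * C2 + 1) d0.
have K0 := lt_trans ltr01 K1; have Kg : 1 <= K `^ gam by rewrite ge1_powR // ltW.
have [T [bT hT]] := s_large C (Num.max a (b + 1)).
apply: (@dilation_power_growth R s al a s_ge0 s_nd al_gt0 a_ge0 s_gt0 K T
  ((2 * C ^+ 2 * C2 + 1) * K `^ gam)) => //.
  by rewrite -ltr_pdivlMr ?powR_gt0 // -gt0_powRB.
move=> t Tt; have := le_trans bT Tt; rewrite ge_max => /andP[at_ bt].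
have bt' : b <= t by rewrite (le_trans _ bt) // lerDl.
have t0 : 0 < t by rewrite (lt_le_trans _ bt) // ltr_wpDl.
have Ct := hT _ Tt.
apply: (le_trans (k_up (K * t) (mulr_ge0 (ltW K0) (ltW t0)))).
have h1 := kC t K bt' t0 (ltW K1).
have h2 : kappa t <= C * (2 * s t) by apply: (le_trans (k_lo _ (ltW t0))); rewrite ler_pM2l //; lra.
have w0 : 0 <= C2 * K `^ gam by rewrite mulr_ge0 ?powR_ge0 ?ltW.
have h3 := le_trans h1 (ler_wpM2l w0 h2).
apply: (le_trans (lerD (ler_wpM2l (ltW C0) h3) (le_trans Ct (ler_peMl (le_trans (ltW C0) Ct) Kg)))).
by rewrite le_eqVlt; apply/orP; left; apply/eqP; ring.
Qed.

End ConcaveEquivalent.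

(** * The cycle of equivalences *)

Theorem theorem2p11 (R : realType) (sigma : R -> R) (alpha a : R)
  (sigma_ge0 : forall x, 0 <= x -> 0 <= sigma x)
  (sigma_ndecr : forall x y, 0 <= x -> x <= y -> sigma x <= sigma y)
  (sigma_oo : sigma x @[x --> +oo] --> +oo)
  (alpha_gt0 : 0 < alpha) (a_ge0 : 0 <= a)
  (sigma_gt0 : forall x, a <= x -> 0 < sigma x) :
  [<->
  (* (i) *)
  integral_cond sigma alpha;
  (* (ii) *)
  (exists kappa : R -> R,
     (forall x, 0 <= x -> 0 <= kappa x) /\
     (forall x y, 0 <= x -> x <= y -> kappa x <= kappa y) /\
     sim_on `[0%R, +oo[ sigma kappa /\
     kappa 0 = sigma 0 / alpha ^+ 2 /\
     integral_cond kappa alpha /\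
     concave_nonneg (fun t => kappa (t `^ alpha^-1)));
  (* (iii) *)
  (fun eps => limsup_pinfty (fun t => eps `^ alpha * sigma t / sigma (eps * t)))
     x @[x --> 0^'+] --> 0%E;
  (* (iv) *)
  (exists K : R, 1 < K /\
     (limsup_pinfty (fun t => (sigma (K * t) / sigma t)%R) < (K `^ alpha)%R%:E)%E);
  (* (v) *)
  ((alpha^-1)%:E < gamma_index sigma)%E;
  (* (vi) *)
  (matuszewska_upper sigma < alpha%:E)%E;
  (* (vii) *)
  (exists gam : R, 0 < gam < alpha /\
     (0 < a -> almost_decreasing_from (fun t => sigma t / t `^ gam) a) /\
     (a = 0 -> forall eps : R, 0 < eps ->
                 almost_decreasing_from (fun t => sigma t / t `^ gam) eps));
  (* (viii) *)
  (exists C : R, 0 < C /\ forall y : R, a <= y ->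
     (\int[lebesgue_measure]_(t in `[a, y])
         ((t `^ alpha / sigma t / t)%R%:E) <= (C * y `^ alpha / sigma y)%R%:E)%E);
  (* (ix) *)
  (exists C : R, 0 < C /\ forall p : nat, (ceiln a + 1 <= p)%N ->
     \sum_(ceiln a + 1 <= k < p.+1) k%:R `^ (alpha - 1) / sigma k%:R
       <= C * (p%:R `^ alpha / sigma p%:R));
  (* (x) *)
  (forall theta : R, 0 < theta < 1 -> exists k : nat, (2 <= k)%N /\
     forall p : nat, (ceiln a + 1 <= p)%N ->
       sigma (k * p)%:R <= theta * k%:R `^ alpha * sigma p%:R);
  (* (xi) *)
  (exists k : nat, (2 <= k)%N /\
     (limn_esup (fun p : nat => (sigma (k * p)%:R / sigma p%:R)%R%:E)
        < (k%:R `^ alpha)%R%:E)%E);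
  (* (xii) *)
  (exists C : R, 0 < C /\ forall p : nat, (1 <= p)%N -> (ceiln a <= p)%N ->
     (\sum_(p <= k <oo) ((sigma k%:R / k%:R `^ (1 + alpha))%R%:E)
        <= (C * (sigma p%:R / p%:R `^ alpha))%R%:E)%E)
  ].
Proof.
have vii_growth : (exists gam : R, 0 < gam < alpha /\
    (0 < a -> almost_decreasing_from (fun t => sigma t / t `^ gam) a) /\
    (a = 0 -> forall eps : R, 0 < eps ->
                almost_decreasing_from (fun t => sigma t / t `^ gam) eps)) ->
    exists2 gam : R, 0 < gam < alpha & power_growth sigma a gam.
  move=> [gam [gam_int [hpos h0]]].
  (* When [a = 0], the starting point 1 is used in place of [a]. *)
  move: (a_ge0); rewrite le_eqVlt => /predU1P[/esym a0|a_gt0].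
    exact: (almost_decreasing_growth sigma alpha a sigma_ge0 sigma_ndecr alpha_gt0
      a_ge0 sigma_gt0 gam 1 gam_int ltr01 (h0 a0 1 ltr01)).
  exact: (almost_decreasing_growth sigma alpha a sigma_ge0 sigma_ndecr alpha_gt0
    a_ge0 sigma_gt0 gam a gam_int a_gt0 (hpos a_gt0)).
(* Each condition implies the next and the last implies the first. All arrows pass through power
   growth except (viii) to (ix) and (x) to (xi), which are direct. *)
split; [|split; [|split; [|split; [|split; [|split; [|split; [|split; [|split; [|split; [|split]]]]]]]]]].
- move=> h; apply: (growth_concave_equivalent _ _ a) => //; apply: tail_sum_growth => //.
  exact: integral_cond_tail_sum.
- move=> [kappa [k_ge0 [k_nd [sim [_ [ik _]]]]]]; apply: (growth_limsup_contraction _ _ a) => //.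
  exact: (concave_equivalent_growth sigma alpha a sigma_ge0 sigma_ndecr alpha_gt0
    a_ge0 sigma_gt0 sigma_oo kappa).
- by move=> h; apply: (growth_limsup_dilation_lt _ _ a) => //; exact: limsup_contraction_growth.
- move=> [K [K1 h]]; apply: (growth_gamma_index _ _ a) => //.
  exact: (limsup_dilation_growth sigma alpha a sigma_ge0 sigma_ndecr alpha_gt0
    a_ge0 sigma_gt0 K).
- by move=> h; apply: (growth_matuszewska _ _ a) => //; exact: gamma_index_growth.
- move=> h; have [gam gam_int sgam] : exists2 gam : R, 0 < gam < alpha &
    power_growth sigma a gam by exact: matuszewska_growth.
  have [gam0 _] := andP gam_int; exists gam; split=> //; split=> [a_gt0|a0 eps eps0].
    exact: growth_almost_decreasing sgam.
  by apply: growth_almost_decreasing sgam => //; rewrite a0 ltW.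
- by move=> h; apply: growth_integral_le => //; exact: vii_growth.
- exact: integral_le_sum_le.
- by move=> h; apply: (growth_nat_dilation _ _ a) => //; exact: sum_le_growth.
- exact: nat_dilation_limsup.
- by move=> h; apply: growth_tail_sum => //; exact: limsup_nat_dilation_growth.
- by move=> h; apply: (growth_integral_cond _ _ _ _ a) => //; exact: tail_sum_growth.
Qed.
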